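(* For every integer $R\ge3$ there exist a threshold number $n_R$ and a constant $C_R>0$, depending only on $R$, such that for all integers $n,m$ with $1\le m\le n-1$, $n\ge n_R$ and $a_{n,2}<1$, $$\sup_{k\in\mathbb{Z}}|\mu\{k\}-\nu_R\{k\}|\le C_R\frac1{(\sqrt n)^R}.$$
   Context: Coupon collector's waiting time: coupons are drawn independently and uniformly at random with replacement from $n$ distinct coupons, and $W_{n,m}$ is the number of draws until $n-m$ distinct coupons have been collected for the first time. Let $\widetilde W_{n,m}=W_{n,m}-(n-m)$; equivalently it is distributed as $\sum_{k=m+1}^n\widetilde X_k$ with independent $\widetilde X_k$ satisfying $\mathbf P(\widetilde X_k=j)=(1-\frac kn)^j\frac kn$, $j=0,1,\ldots$. Let $\sigma_n^2=\mathbf{Var}(W_{n,m})=n\sum_{k=m+1}^n\frac{n-k}{k^2}$ and, for $j\ge1$, $a_{n,j}=\sum_{k=m+1}^n\left(\frac{n-k}k\right)^j$. Let $\mu$ be the distribution of $\widetilde W_{n,m}+c$, where $c=\lfloor a_{n,2}\rfloor$ (so $c=0$ when $a_{n,2}<1$). For an integer $R\ge3$ define polynomials $$h_R(w)=-a_{n,2}w+a_{n,2}\frac{w^2}2+\sum_{r=3}^Ra_{n,r}\frac{w^r}r,\qquad H_R(w)=\sum_{l=0}^{3R-2}\frac{h_R(w)^l}{l!}.$$ $\nu_R$ is the finite signed measure on the nonnegative integers (a Poisson–Charlier signed measure) whose characteristic function is $$\sum_{j\ge0}e^{itj}\nu_R\{j\}=\exp\{\sigma_n^2(e^{it}-1)\}\,H_R(e^{it}-1),\qquad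 t\in\mathbb{R}.$$ *)

(* Defs.v *)
From HB Require Import structures.
From mathcomp Require Import all_boot all_order all_algebra.
From mathcomp Require Import all_classical all_reals all_analysis.
From mathcomp Require Import complex.

Set Implicit Arguments.
Unset Strict Implicit.
Unset Printing Implicit Defensive.

Import Order.TTheory GRing.Theory Num.Theory.
Import numFieldNormedType.Exports.

Local Open Scope classical_set_scope.
Local Open Scope ring_scope.
Local Open Scope complex_scope.

Record uniform_draws d (T : measurableType d) (K : realType)
    (P : probability T K) (n : nat) (X : nat -> T -> 'I_n) : Prop :=
  UniformDraws {
    draw_measurable : forall i (a : 'I_n), measurable (X i @^-1` [set a]);
    draw_uniform : forall i (a : 'I_n),
      P (X i @^-1` [set a]) = (n%:R^-1)%:E;
    draw_independent : forall (s : seq nat) (A : nat -> set 'I_n), uniq s ->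
      P (\bigcap_(i in [set` s]) (X i @^-1` A i)) =
        (\prod_(i <- s) P (X i @^-1` A i))%E }.

Definition num_collected (T : Type) (n : nat) (X : nat -> T -> 'I_n) (t : nat)
    (w : T) : nat :=
  size (undup (mkseq (fun i => X i w) t)).

(* [W_{n,m}]; it is [+oo] on the null event that [n - m] distinct coupons
   are never collected. *)
Definition waiting_time (K : realType) (T : Type) (n : nat)
    (X : nat -> T -> 'I_n) (m : nat) (w : T) : \bar K :=
  ereal_inf [set t%:R%:E
    | t in [set t : nat | (n - m <= num_collected X t w)%N]].

Definition coef_a (K : realType) (n m j : nat) : K :=
  \sum_(m.+1 <= k < n.+1) ((n - k)%:R / k%:R) ^+ j.

(* Closed form of the variance of [W_{n,m}]: the waiting time is a sum of
   independent geometric variables with success probabilities [k / n],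
   [m < k <= n], each of variance [n * (n - k) / k ^ 2]. *)
Definition sigma2 (K : realType) (n m : nat) : K :=
  n%:R * \sum_(m.+1 <= k < n.+1) (n - k)%:R / k%:R ^+ 2.

Definition shifted_time (K : realType) (T : Type) (n : nat) (X : nat -> T -> 'I_n)
    (m : nat) (w : T) : \bar K :=
  (waiting_time K X m w - (n - m)%:R%:E
   + (Num.floor (coef_a K n m 2))%:~R%:E)%E.

(* The point masses [mu{k}] of the law of the shifted waiting time. *)
Definition shifted_law d (T : measurableType d) (K : realType)
    (P : probability T K) (n : nat) (X : nat -> T -> 'I_n) (m : nat)
    (k : int) : \bar K :=
  P [set w | shifted_time K X m w = k%:~R%:E].

Definition poly_h (K : realType) (n m R : nat) : {poly K} :=
  - coef_a K n m 2 *: 'X + (coef_a K n m 2 / 2) *: 'X^2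
  + \sum_(3 <= r < R.+1) (coef_a K n m r / r%:R) *: 'X^r.

Definition poly_H (K : realType) (n m R : nat) : {poly K} :=
  \sum_(0 <= l < (3 * R - 2).+1) (l`!%:R)^-1 *: poly_h K n m R ^+ l.

Definition expi (K : realType) (t : K) : K[i] := cos t +i* sin t.

Definition cexp (K : realType) (z : K[i]) : K[i] :=
  (expR (complex.Re z))%:C * expi (complex.Im z).

Definition has_charfun (K : realType) (nu : {charge set nat -> \bar K})
    (phi : K -> K[i]) : Prop :=
  forall t : K,
    (\sum_(0 <= j < N) expi (t * j%:R) * (fine (nu [set j]))%:C : K[i]^o)
      @[N --> \oo] --> (phi t : K[i]^o).

(* A charge on [nat] is finite, so its characteristic function determines it:
   at most one [nu] satisfies this predicate. *)
Definition poisson_charlier (K : realType) (n m R : nat)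
    (nu : {charge set nat -> \bar K}) : Prop :=
  has_charfun nu (fun t => let w := expi t - 1 in
    cexp ((sigma2 K n m)%:C * w) * (map_poly (real_complex K) (poly_H K n m R)).[w]).

(* Main.v *)
(** With [w = z - 1] and [q_k = (n - k) / k], the generating function of
    [W - (n - m)] is the product over [m < k <= n] of [1 / (1 - q_k w)], which is
    [exp (sigma^2 w + h_R(w))] up to a factor [1 + O(a_{R+1} |w|^(R+1))].  On the
    unit circle [|exp (sigma^2 w)| = exp (- sigma^2 |w|^2 / 2)], so its distance
    to the characteristic function of [nu] is at most a constant times
      [exp (- sigma^2 |w|^2 / 2) (a_{R+1} |w|^(R+1) + (a_2 |w|)^(3R-1))].
    Fourier inversion bounds the difference of the point masses by
      [a_{R+1} / sigma^(R+2) + a_2^(3R-1) / sigma^(3R)],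
    and for [M = n - m - 1] the estimates [a_j <= M (5 M / (4 n))^j],
    [sigma^2 >= M^2 / (2 n)] and [M^3 <= 3 n^2] (from [a_2 < 1]) make both terms
    [O(n^(-R/2))].  The inversion integral is replaced by averages over the
    [Q]-th roots of unity with [Q] large, where the Gaussian factor is dominated
    by a Poisson kernel, whose average is a geometric series. *)

Require Import Defs.
From HB Require Import structures.
From mathcomp Require Import all_boot all_order all_algebra.
From mathcomp Require Import all_classical all_reals all_analysis.
From mathcomp Require Import complex ring lra zify.

Set Implicit Arguments.
Unset Strict Implicit.
Unset Printing Implicit Defensive.

Import Order.TTheory GRing.Theory Num.Theory.
Import numFieldNormedType.Exports.
Local Open Scope classical_set_scope.
Local Open Scope ring_scope.
Local Open Scope complex_scope.

(** The truncation at $l\le 3R-2$ is dictated by the largest $M$ that $a_2<1$ allows, $M$ of order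
    $n^{2/3}$: there $a_2$ is of order 1 and $\sigma$ of order $n^{1/6}$, so only $\sigma^{-3R}$
    reaches $n^{-R/2}$. For smaller $M$ the gain comes from $a_2/\sigma^3=O(n^{-1/2})$, used $R$
    times, while the other $2R-1$ factors $a_2$ stay bounded. In the term with $a_{R+1}$ the powers
    of $M$ cancel exactly.

    Since $\sigma$ can be as small as order $n^{-1/2}$, the inversion step has to gain the factor
    $1/\sigma$ for every positive $\sigma$, not only for large ones. The case $M=0$ is separate:
    there $\sigma=0$ and the two characteristic functions coincide.

    Complex logarithms and contour arguments are avoided. Each factor $1-q_kw$ is multiplied by the
    exponential of a truncated logarithm, and all remainders are bounded by the real mean value
    theorem along a segment from 0. The law of the waiting time is found by counting finite draw
    sequences, without constructing independent geometric variables. *)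

Section ComplexModulus.
Variable K : realType.
Implicit Types z w : K[i].

(** The norm on [K[i]] takes values in [K[i]]; its real part turns every estimate into an inequality
    between real numbers, where [expR] and the order tactics apply. *)
Definition cmod z : K := complex.Re `|z|.

Lemma cmodE z : `|z| = (cmod z)%:C.
Proof. by rewrite /cmod normc_def. Qed.

Lemma cmod_ge0 z : 0 <= cmod z.
Proof. by rewrite -ler0c -cmodE. Qed.

Lemma cmodM z w : cmod (z * w) = cmod z * cmod w.
Proof. by apply: complexI; rewrite rmorphM /= -!cmodE normrM. Qed.

Lemma cmodV z : cmod z^-1 = (cmod z)^-1.
Proof. by apply: complexI; rewrite fmorphV /= -!cmodE normfV. Qed.

Lemma cmod_real (x : K) : cmod x%:C = `|x|.
Proof. by rewrite /cmod normc_def /= expr0n addr0 sqrtr_sqr. Qed.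

Lemma cmod0 : cmod 0 = 0.
Proof. by rewrite /cmod normr0. Qed.

Lemma cmod1 : cmod 1 = 1.
Proof. by rewrite /cmod normr1. Qed.

Lemma cmodX z n : cmod (z ^+ n) = cmod z ^+ n.
Proof. by apply: complexI; rewrite rmorphXn /= -!cmodE normrX. Qed.

Lemma cmodN z : cmod (- z) = cmod z.
Proof. by rewrite /cmod normrN. Qed.

Lemma cmodD z w : cmod (z + w) <= cmod z + cmod w.
Proof. by rewrite -lecR rmorphD /= -!cmodE ler_normD. Qed.

Lemma cmodB z w : cmod (z - w) <= cmod z + cmod w.
Proof. by rewrite -(cmodN w) cmodD. Qed.

Lemma cmod_dist z w : cmod (z - w) = cmod (w - z).
Proof. by rewrite -cmodN opprB. Qed.

Lemma cmod_eq0 z : (cmod z == 0) = (z == 0).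
Proof. by rewrite -[RHS]normr_eq0 cmodE -(inj_eq (@complexI K)). Qed.

Lemma cmod_sum (I : Type) (r : seq I) (P : pred I) (F : I -> K[i]) :
  cmod (\sum_(i <- r | P i) F i) <= \sum_(i <- r | P i) cmod (F i).
Proof.
rewrite -lecR rmorph_sum /= -cmodE.
rewrite [leRHS](eq_bigr (fun i => `|F i|)) ?ler_norm_sum// => i _; exact/esym/cmodE.
Qed.

Lemma sqr_cmod z : cmod z ^+ 2 = complex.Re z ^+ 2 + complex.Im z ^+ 2.
Proof. by apply: complexI; rewrite rmorphXn /= -cmodE -add_Re2_Im2. Qed.

Lemma Re_le_cmod z : `|complex.Re z| <= cmod z.
Proof.
rewrite -[leLHS]sqrtr_sqr -[leRHS](ger0_norm (cmod_ge0 z)) -[leRHS]sqrtr_sqr.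
by rewrite ler_sqrt ?sqr_ge0// sqr_cmod lerDl sqr_ge0.
Qed.

Lemma Im_le_cmod z : `|complex.Im z| <= cmod z.
Proof.
rewrite -[leLHS]sqrtr_sqr -[leRHS](ger0_norm (cmod_ge0 z)) -[leRHS]sqrtr_sqr.
by rewrite ler_sqrt ?sqr_ge0// sqr_cmod lerDr sqr_ge0.
Qed.

Lemma cmod_le_ReIm z : cmod z <= `|complex.Re z| + `|complex.Im z|.
Proof.
rewrite -ler_sqr ?nnegrE ?cmod_ge0 ?addr_ge0//.
rewrite sqr_cmod sqrrD !real_normK ?num_real//.
by rewrite lerD2r lerDl mulrn_wge0// mulr_ge0.
Qed.

Lemma cmod_nat n : cmod n%:R = n%:R.
Proof. by rewrite -(rmorph_nat (real_complex K)) /= cmod_real ger0_norm. Qed.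

End ComplexModulus.

(** * The complex exponential and points of the unit circle *)

Section ComplexExponential.
Variable K : realType.
Implicit Types (z w : K[i]) (s t : K).

Lemma expiD s t : expi (s + t) = expi s * expi t.
Proof.
rewrite /expi cosD sinD; apply/eqP; rewrite eq_complex /=.
by rewrite eqxx /= addrC.
Qed.

Lemma expi0 : expi (0 : K) = 1.
Proof. by rewrite /expi cos0 sin0. Qed.

Lemma expiMn t n : expi (t * n%:R) = expi t ^+ n.
Proof.
elim: n => [|n IH]; first by rewrite mulr0 expi0.
by rewrite -natr1 mulrDr mulr1 expiD IH exprSr.
Qed.

Lemma cmod_expi t : cmod (expi t) = 1.
Proof.
apply/eqP; rewrite -(@eqrXn2 _ 2) ?cmod_ge0//; apply/eqP.
by rewrite sqr_cmod /= cos2Dsin2 expr1n.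
Qed.

Lemma sqr_cmod_expiB1 t : cmod (expi t - 1) ^+ 2 = 2 * (1 - cos t).
Proof.
rewrite sqr_cmod /= oppr0 addr0 sin2cos2; ring.
Qed.

Lemma cexpD z w : cexp (z + w) = cexp z * cexp w.
Proof.
by rewrite /cexp !raddfD /= expRD expiD rmorphM mulrACA.
Qed.

Lemma cexp0 : cexp (0 : K[i]) = 1.
Proof. by rewrite /cexp /= expR0 expi0 mul1r. Qed.

Lemma cexp_neq0 z : cexp z != 0.
Proof.
apply/eqP => z0; have := cexpD z (- z).
by rewrite subrr cexp0 z0 mul0r; apply/eqP; rewrite oner_eq0.
Qed.

Lemma cexpN z : cexp (- z) = (cexp z)^-1.
Proof.
by apply: (mulfI (cexp_neq0 z)); rewrite mulfV ?cexp_neq0// -cexpD subrr cexp0.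
Qed.

Lemma cexp_sum (I : Type) (r : seq I) (P : pred I) (F : I -> K[i]) :
  cexp (\sum_(i <- r | P i) F i) = \prod_(i <- r | P i) cexp (F i).
Proof.
exact: (big_morph (@cexp K) cexpD cexp0).
Qed.

Lemma cmod_cexp z : cmod (cexp z) = expR (complex.Re z).
Proof.
by rewrite /cexp cmodM cmod_real cmod_expi mulr1 ger0_norm// expR_ge0.
Qed.

Lemma cmod_cexp_le z : cmod (cexp z) <= expR (cmod z).
Proof.
by rewrite cmod_cexp ler_expR (le_trans (ler_norm _))// Re_le_cmod.
Qed.

End ComplexExponential.

(** * Derivatives of complex functions of one real variable *)

Section ComplexDerivative.
Variable K : realType.
Implicit Types (f g : K -> K[i]) (s : K) (z d e : K[i]).

(** Differentiation by components, so that the real mean value theorem applies. Only restrictions to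
    rays [u%:C * z] with real [u] are ever differentiated. *)
Definition is_cderive f s d :=
  is_derive s 1 (fun u => complex.Re (f u)) (complex.Re d) /\
  is_derive s 1 (fun u => complex.Im (f u)) (complex.Im d).

Lemma is_cderive_eq f s d e : is_cderive f s d -> d = e -> is_cderive f s e.
Proof. by move=> ? <-. Qed.

Lemma is_cderive_cst z s : is_cderive (fun=> z) s 0.
Proof. by split; exact: is_derive_cst. Qed.

Lemma is_cderive_real s : is_cderive (real_complex K) s 1.
Proof. by split=> /=; [exact: is_derive_id | exact: is_derive_cst]. Qed.

Lemma is_cderiveD f g s d e : is_cderive f s d -> is_cderive g s e ->
  is_cderive (fun u => f u + g u) s (d + e).
Proof.
move=> [df1 df2] [dg1 dg2]; split; rewrite raddfD /=.
  rewrite [X in is_derive _ _ X _](_ : _ = (fun u => complex.Re (f u)) \+ (fun u =>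
      complex.Re (g u))); last first.
    by apply/funext => u; rewrite raddfD.
  exact: is_deriveD.
rewrite [X in is_derive _ _ X _](_ : _ = (fun u => complex.Im (f u)) \+ (fun u =>
    complex.Im (g u))); last first.
  by apply/funext => u; rewrite raddfD.
exact: is_deriveD.
Qed.

Lemma ReD z w : complex.Re (z + w) = complex.Re z + complex.Re w.
Proof. by case: z w => [a b] [c d]. Qed.

Lemma ImD z w : complex.Im (z + w) = complex.Im z + complex.Im w.
Proof. by case: z w => [a b] [c d]. Qed.

Lemma ReM z w : complex.Re (z * w) = complex.Re z * complex.Re w - complex.Im z *
    complex.Im w.
Proof. by case: z w => [a b] [c d]. Qed.

Lemma ImM z w : complex.Im (z * w) = complex.Re z * complex.Im w + complex.Im z *
    complex.Re w.
Proof. by case: z w => [a b] [c d]. Qed.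

Lemma is_cderiveM f g s d e : is_cderive f s d -> is_cderive g s e ->
  is_cderive (fun u => f u * g u) s (d * g s + f s * e).
Proof.
move=> [df1 df2] [dg1 dg2]; split.
  rewrite (_ : (fun u => complex.Re (f u * g u)) =
    (fun u => complex.Re (f u)) * (fun u => complex.Re (g u)) -
    (fun u => complex.Im (f u)) * (fun u => complex.Im (g u))); last first.
    by apply/funext => u; rewrite ReM.
  apply: (is_derive_eq (is_deriveB (is_deriveM df1 dg1) (is_deriveM df2 dg2))).
  rewrite ReD !ReM /GRing.scale /=; ring.
rewrite (_ : (fun u => complex.Im (f u * g u)) =
    (fun u => complex.Re (f u)) * (fun u => complex.Im (g u)) +
    (fun u => complex.Im (f u)) * (fun u => complex.Re (g u))); last first.
  by apply/funext => u; rewrite ImM.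
apply: (is_derive_eq (is_deriveD (is_deriveM df1 dg2) (is_deriveM df2 dg1))).
rewrite ImD !ImM /GRing.scale /=; ring.
Qed.

Lemma is_cderive_cexp f s d : is_cderive f s d ->
  is_cderive (fun u => cexp (f u)) s (d * cexp (f s)).
Proof.
move=> [d1 d2].
have E : is_derive s 1 (expR \o (fun u => complex.Re (f u)))
    (complex.Re d * expR (complex.Re (f s))).
  by apply: is_derive_eq; rewrite mulrC.
have C : is_derive s 1 (@cos K \o (fun u => complex.Im (f u)))
    (- sin (complex.Im (f s)) * complex.Im d).
  by apply: is_derive_eq; rewrite mulrC.
have S : is_derive s 1 (@sin K \o (fun u => complex.Im (f u)))
    (cos (complex.Im (f s)) * complex.Im d).
  by apply: is_derive_eq; rewrite mulrC.
split.
  rewrite (_ : (fun u => complex.Re (cexp (f u))) =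
     (expR \o (fun u => complex.Re (f u))) * (@cos K \o (fun u => complex.Im (f u))));
         last first.
    by apply/funext => u; rewrite /cexp ReM /= mul0r subr0.
  apply: is_derive_eq; rewrite ReM /cexp ReM ImM /GRing.scale /=; ring.
rewrite (_ : (fun u => complex.Im (cexp (f u))) =
   (expR \o (fun u => complex.Re (f u))) * (@sin K \o (fun u => complex.Im (f u))));
       last first.
  by apply/funext => u; rewrite /cexp ImM /= mul0r addr0.
apply: is_derive_eq; rewrite ImM /cexp ReM ImM /GRing.scale /=; ring.
Qed.

Lemma is_cderive_ray z s : is_cderive (fun u => u%:C * z) s z.
Proof.
apply: is_cderive_eq (is_cderiveM (is_cderive_real s) (is_cderive_cst z s)) _.
by rewrite mul1r mulr0 addr0.
Qed.

Lemma is_cderive_poly (p : {poly K[i]}) z s :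
  is_cderive (fun u => p.[u%:C * z]) s (z * p^`().[s%:C * z]).
Proof.
elim/poly_ind: p => [|p c IH].
  rewrite (_ : (fun u => _) = fun=> 0); last by apply/funext => u; rewrite horner0.
  by apply: is_cderive_eq (is_cderive_cst 0 s) _; rewrite deriv0 horner0 mulr0.
rewrite (_ : (fun u => _) = fun u => p.[u%:C * z] * (u%:C * z) + c); last first.
  by apply/funext => u; rewrite !hornerE.
apply: is_cderive_eq (is_cderiveD (is_cderiveM IH (is_cderive_ray z s)) (is_cderive_cst
    c s)) _.
rewrite derivD derivM derivX derivC mulr1 !addr0 hornerD hornerM hornerX; ring.
Qed.

Lemma is_derive_le_dist (h dh : K -> K) (B : K) :
  (forall s, is_derive s 1 h (dh s)) ->
  (forall s, 0 <= s <= 1 -> `|dh s| <= B) -> `|h 1 - h 0| <= B.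
Proof.
move=> hd hB.
have [c c01 ->] : exists2 c, c \in `]0, 1[%R & h 1 - h 0 = dh c * (1 - 0).
  apply: (@MVT K h dh 0 1) => //.
  apply: derivable_within_continuous => x _.
  exact: (@ex_derive _ _ _ _ _ _ _ (hd x)).
rewrite subr0 mulr1; apply: hB.
by move: c01; rewrite in_itv /= => /andP[/ltW -> /ltW ->].
Qed.

(** The mean value theorem has no complex-valued form; it is applied to the real and the imaginary
    part separately, whence the factor 2. *)
Lemma cderive_le_dist f (df : K -> K[i]) (B : K) :
  (forall s, is_cderive f s (df s)) ->
  (forall s, 0 <= s <= 1 -> cmod (df s) <= B) -> cmod (f 1 - f 0) <= 2 * B.
Proof.
move=> fd fB; apply: (le_trans (cmod_le_ReIm _)).
rewrite !raddfB /= mulr_natl mulr2n; apply: lerD.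
  apply: (@is_derive_le_dist (fun u => complex.Re (f u)) (fun u => complex.Re (df u))).
    by move=> s; have [] := fd s.
  by move=> s /fB; apply: le_trans; exact: Re_le_cmod.
apply: (@is_derive_le_dist (fun u => complex.Im (f u)) (fun u => complex.Im (df u))).
  by move=> s; have [] := fd s.
by move=> s /fB; apply: le_trans; exact: Im_le_cmod.
Qed.

End ComplexDerivative.

(** * Remainders of the exponential and of the Weierstrass factors *)

Section ExponentialTaylor.
Variable K : realType.
Implicit Types (z x w : K[i]).

(** Taylor polynomial of exp with [L] terms, hence of degree [L - 1]. *)
Definition expoly L : {poly K[i]} := \sum_(l < L) (l`!%:R)^-1 *: 'X^l.

Lemma expolyS L : expoly L.+1 = expoly L + (L`!%:R)^-1 *: 'X^L.
Proof. by rewrite /expoly big_ord_recr. Qed.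

Lemma horner_expoly L z : (expoly L).[z] = \sum_(l < L) z ^+ l / l`!%:R.
Proof.
by rewrite horner_sum; apply: eq_bigr => l _; rewrite hornerZ hornerXn mulrC.
Qed.

Lemma deriv_expoly L : (expoly L.+1)^`() = expoly L.
Proof.
elim: L => [|L IH].
  by rewrite /expoly big_ord1 big_ord0 expr0 alg_polyC derivC.
rewrite expolyS derivD IH derivZ derivXn /= expolyS -scalerMnr scalerMnl -mulr_natr.
congr (_ + _ *: _); rewrite factS natrM invfM mulrAC mulVf ?mul1r// pnatr_eq0.
Qed.

Lemma expoly_at0 L : (expoly L.+1).[0] = 1.
Proof.
rewrite horner_expoly big_ord_recl /= expr0 fact0 divr1 big1 ?addr0// => i _.
by rewrite /bump /= exprS mul0r mul0r.
Qed.

Lemma cmod_segment (s : K) z : 0 <= s <= 1 -> cmod (s%:C * z) <= cmod z.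
Proof.
move=> /andP[s0 s1]; rewrite cmodM cmod_real ger0_norm//.
by rewrite ler_piMl// cmod_ge0.
Qed.

(** Along the segment, $u\mapsto e^{-uz}\,T_L(uz)$, with $T_L$ the Taylor polynomial of degree $L$,
    has a telescoping derivative: only $-z e^{-uz}(uz)^L/L!$ survives. Multiplying the resulting
    bound by $|e^z|$ gives the second factor [expR (cmod z)]. *)
Lemma cexp_taylor z L :
  cmod (cexp z - (expoly L.+1).[z]) <= 2 * cmod z ^+ L.+1 * expR (2 * cmod z).
Proof.
pose g (u : K) := cexp (u%:C * (- z)) * (expoly L.+1).[u%:C * z].
pose dg (u : K) := - (z * cexp (u%:C * (- z)) * (L`!%:R)^-1 * (u%:C * z) ^+ L).
have gd u : is_cderive g u (dg u).
  apply: is_cderive_eq (is_cderiveM (is_cderive_cexp (is_cderive_ray (- z) u))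
    (is_cderive_poly (expoly L.+1) z u)) _.
  rewrite deriv_expoly expolyS hornerD hornerZ hornerXn /dg; ring.
have dgB u : 0 <= u <= 1 -> cmod (dg u) <= cmod z ^+ L.+1 * expR (cmod z).
  move=> u01; rewrite /dg.
  have h1 : cmod (cexp (u%:C * - z)) <= expR (cmod z).
    apply: (le_trans (cmod_cexp_le _)); rewrite ler_expR.
    by rewrite (le_trans (cmod_segment _ u01))// cmodN.
  have h2 : cmod (u%:C * z) ^+ L <= cmod z ^+ L.
    by rewrite lerXn2r ?nnegrE ?cmod_ge0// cmod_segment.
  have h3 : (L`!%:R : K)^-1 <= 1 by rewrite invf_le1 ?ltr0n ?fact_gt0// ler1n fact_gt0.
  rewrite cmodN 3!cmodM cmodX cmodV cmod_nat exprS.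
  rewrite [leRHS](_ : _ = cmod z * expR (cmod z) * 1 * cmod z ^+ L); last by ring.
  apply: ler_pM => //; rewrite ?exprn_ge0 ?mulr_ge0 ?invr_ge0 ?cmod_ge0//.
  apply: ler_pM => //; rewrite ?exprn_ge0 ?mulr_ge0 ?invr_ge0 ?cmod_ge0//.
  by rewrite ler_wpM2l ?cmod_ge0.
have := cderive_le_dist gd dgB.
rewrite /g !mul1r !mul0r cexp0 expoly_at0 mul1r cexpN => gB.
have -> : cexp z - (expoly L.+1).[z] =
    - cexp z * ((cexp z)^-1 * (expoly L.+1).[z] - 1).
  by rewrite mulrBr mulNr mulrA mulfV ?cexp_neq0// mul1r mulr1 opprK addrC.
rewrite (cmodM (- cexp z)) cmodN (_ : 2 * cmod z = cmod z + cmod z); last by ring.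
rewrite expRD (_ : _ * (expR _ * _) = expR (cmod z) * (2 * (cmod z ^+ L.+1 * expR (cmod
    z)))); last by ring.
by rewrite ler_pM ?cmod_ge0// cmod_cexp_le.
Qed.

(* The Taylor polynomial of [- ln (1 - x)]. *)
Definition logpoly R : {poly K[i]} := \sum_(r < R) (r.+1%:R)^-1 *: 'X^(r.+1).

Lemma horner_logpoly R x : (logpoly R).[x] = \sum_(r < R) x ^+ r.+1 / r.+1%:R.
Proof.
by rewrite horner_sum; apply: eq_bigr => l _; rewrite hornerZ hornerXn mulrC.
Qed.

Lemma deriv_logpoly R : (logpoly R)^`() = \sum_(r < R) 'X^r.
Proof.
rewrite /logpoly raddf_sum; apply: eq_bigr => r _ /=.
by rewrite derivZ derivXn /= -scalerMnr scalerMnl -mulr_natr mulVf ?scale1r// pnatr_eq0.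
Qed.

Lemma cmod_logpoly R x : cmod x <= 1 -> cmod (logpoly R).[x] <= R%:R.
Proof.
move=> x1; rewrite horner_logpoly; apply: (le_trans (cmod_sum _ _ _)).
rewrite -[X in _ <= X%:R]card_ord -sumr_const; apply: ler_sum => i _.
rewrite cmodM cmodX cmodV cmod_nat mulr_ile1 ?exprn_ge0 ?cmod_ge0 ?invr_ge0//.
  by rewrite exprn_ile1 ?cmod_ge0.
by rewrite invf_le1 ?ltr0n// ler1n.
Qed.

(** For $|x|<1$ this is $\exp(-\sum_{r>R}x^r/r)$, so it plays the role of the tail of the logarithm
    without a complex logarithm being defined. *)
Definition weierstrass_factor R x := (1 - x) * cexp (logpoly R).[x].

(** With $p$ the truncated logarithm, $(1-X)p'=1-X^R$, so the derivative along the segment collapses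
    to $-x(ux)^R e^{p(ux)}$, which already carries the order $|x|^{R+1}$; and $|p|\le R$ on the unit
    disc. *)
Lemma cmod_weierstrass_factorB1 R x : cmod x <= 1 ->
  cmod (weierstrass_factor R x - 1) <= 2 * expR R%:R * cmod x ^+ R.+1.
Proof.
move=> x1.
pose p := logpoly R.
pose f (u : K) := (1 - 'X : {poly K[i]}).[u%:C * x] * cexp (p.[u%:C * x]).
pose df (u : K) := - (x * (u%:C * x) ^+ R * cexp (p.[u%:C * x])).
have fd u : is_cderive f u (df u).
  apply: is_cderive_eq (is_cderiveM (is_cderive_poly (1 - 'X) x u)
     (is_cderive_cexp (is_cderive_poly p x u))) _.
  have E : (1 - 'X) * p^`() = 1 - 'X^R.
    by rewrite deriv_logpoly; apply: oppr_inj; rewrite opprB subrX1 -mulNr opprB.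
  have {}E : (1 - u%:C * x) * p^`().[u%:C * x] = 1 - (u%:C * x) ^+ R.
    have := congr1 (fun q => q.[u%:C * x]) E.
    by rewrite hornerM !hornerD !hornerN !hornerX !hornerC hornerXn.
  rewrite /df derivB derivX derivC !hornerD !hornerN !hornerX !hornerC.
  rewrite (_ : _ + _ = - (x * cexp p.[u%:C * x]) +
     x * cexp p.[u%:C * x] * ((1 - u%:C * x) * p^`().[u%:C * x])); last by ring.
  rewrite E; ring.
have dfB u : 0 <= u <= 1 -> cmod (df u) <= expR R%:R * cmod x ^+ R.+1.
  move=> u01; rewrite /df cmodN 2!cmodM cmodX [leRHS]mulrC exprS.
  rewrite ler_pM ?mulr_ge0 ?exprn_ge0 ?cmod_ge0//.
    rewrite ler_wpM2l ?cmod_ge0// lerXn2r ?nnegrE ?cmod_ge0//.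
    exact: cmod_segment.
  apply: (le_trans (cmod_cexp_le _)); rewrite ler_expR cmod_logpoly//.
  exact: le_trans (cmod_segment _ u01) x1.
have := cderive_le_dist fd dfB.
have -> : f 1 = weierstrass_factor R x by rewrite /f mul1r hornerD hornerN hornerX hornerC.
have -> : f 0 = 1.
  rewrite /f mul0r hornerD hornerN hornerX hornerC subr0 mul1r.
  rewrite (_ : p.[0] = 0) ?cexp0//.
  by rewrite horner_logpoly big1// => i _; rewrite exprS !mul0r.
by rewrite mulrA.
Qed.

(** The inverse costs one more factor $2e^R$, because $|1-x|\ge 1/2$ and $|e^{-p(x)}|\le e^R$. *)
Lemma cmod_weierstrass_factorV_B1 R x : cmod x <= 2^-1 ->
  cmod ((weierstrass_factor R x)^-1 - 1) <= 4 * expR R%:R ^+ 2 * cmod x ^+ R.+1.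
Proof.
move=> x2.
have x1 : cmod x <= 1 by apply: (le_trans x2); rewrite invf_le1// ler1n.
have h1 : 2^-1 <= cmod (1 - x).
  have := cmodD (1 - x) x; rewrite subrK cmod1; lra.
have nx : 1 - x != 0 by rewrite -cmod_eq0 gt_eqF// (lt_le_trans _ h1)// invr_gt0.
have n0 : weierstrass_factor R x != 0 by rewrite mulf_neq0// cexp_neq0.
have -> : (weierstrass_factor R x)^-1 - 1 = (weierstrass_factor R x)^-1 * (1 -
    weierstrass_factor R x).
  by rewrite mulrBr mulr1 mulVf.
rewrite cmodM cmodV cmod_dist.
have h2 : (cmod (weierstrass_factor R x))^-1 <= 2 * expR R%:R.
  rewrite /weierstrass_factor cmodM invfM ler_pM ?invr_ge0 ?cmod_ge0//.
    by rewrite -[leRHS]invrK lef_pV2 ?posrE ?invr_gt0//; lra.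
  rewrite -cmodV -cexpN (le_trans (cmod_cexp_le _))// ler_expR cmodN.
  exact: cmod_logpoly.
apply: le_trans (ler_pM _ _ h2 (cmod_weierstrass_factorB1 R x1)) _.
- by rewrite invr_ge0 cmod_ge0.
- exact: cmod_ge0.
by rewrite le_eqVlt; apply/orP; left; apply/eqP; ring.
Qed.

(** Induction through $yP-1=y(P-1)+(y-1)$, with $|y|\le 1+b\le e^b$. *)
Lemma cmod_prodB1 (I : eqType) (r : seq I) (y : I -> K[i]) (b : I -> K) :
  {in r, forall i, 0 <= b i} -> {in r, forall i, cmod (y i - 1) <= b i} ->
  cmod (\prod_(i <- r) y i - 1) <= (\sum_(i <- r) b i) * expR (\sum_(i <- r) b i).
Proof.
elim: r => [_ _|i r IH b0 yb].
  by rewrite !big_nil subrr cmod0 mul0r.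
have {}IH := IH (sub_in1 (@mem_behead _ (i :: r)) b0) (sub_in1 (@mem_behead _ (i :: r)) yb).
have bi0 : 0 <= b i by apply: b0; exact: mem_head.
have ybi : cmod (y i - 1) <= b i by apply: yb; exact: mem_head.
have : 0 <= \sum_(j <- r) b j.
  by rewrite big_seq sumr_ge0// => j jr; apply: b0; rewrite inE jr orbT.
rewrite !big_cons; move: IH; set P := \prod_(_ <- _) _; set B := \sum_(_ <- _) _ => IH B0.
have -> : y i * P - 1 = ((y i - 1) + 1) * (P - 1) + (y i - 1) by ring.
apply: (le_trans (cmodD _ _)); rewrite cmodM.
have h1 : cmod (y i - 1 + 1) <= expR (b i).
  apply: (le_trans (cmodD _ _)); rewrite cmod1.
  by apply: le_trans (expR_ge1Dx _); rewrite addrC lerD2l.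
rewrite mulrDl addrC; apply: lerD.
  apply: (le_trans ybi); rewrite -[leLHS]mulr1 ler_wpM2l//.
  by rewrite -expR0 ler_expR addr_ge0.
apply: le_trans (ler_pM _ _ h1 IH) _; rewrite ?cmod_ge0//.
by rewrite expRD mulrCA.
Qed.

End ExponentialTaylor.

(** * Distance of the two characteristic functions at a single point *)

Section PointwiseEstimate.
Variable K : realType.
Implicit Types (w : K[i]) (a : nat -> K) (R : nat).

(** The polynomial of the statement with an abstract coefficient sequence; at [a := coef_a K n m] it
    is [poly_h] by conversion. *)
Definition hpoly a R : {poly K} :=
  - a 2%N *: 'X + (a 2%N / 2) *: 'X^2
  + \sum_(3 <= r < R.+1) (a r / r%:R) *: 'X^r.

Definition Hpoly a R : {poly K} :=
  \sum_(0 <= l < (3 * R - 2).+1) (l`!%:R)^-1 *: hpoly a R ^+ l.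

Definition chorner (p : {poly K}) w := (map_poly (real_complex K) p).[w].

Lemma chornerE a R w : chorner (hpoly a R) w =
  - (a 2%N)%:C * w + (a 2%N / 2)%:C * w ^+ 2
  + \sum_(3 <= r < R.+1) (a r / r%:R)%:C * w ^+ r.
Proof.
rewrite /chorner /hpoly !rmorphD /= !map_polyZ /= map_polyX map_polyXn !hornerD
    !hornerZ hornerX hornerXn.
rewrite rmorphN; congr (_ + _).
rewrite rmorph_sum horner_sum; apply: eq_bigr => i _.
by rewrite /= map_polyZ /= map_polyXn hornerZ hornerXn.
Qed.

Lemma chorner_Hpoly a R w :
  chorner (Hpoly a R) w = (expoly K (3 * R - 2).+1).[chorner (hpoly a R) w].
Proof.
rewrite /chorner /Hpoly big_mkord rmorph_sum horner_sum horner_expoly.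
apply: eq_bigr => i _ /=.
rewrite map_polyZ /= rmorphXn hornerZ horner_exp mulrC.
by rewrite fmorphV rmorph_nat.
Qed.

(** This explains the linear term $-a_2w$ of $h_R$: the logarithm starts with $a_1w$, but the
    Gaussian factor uses the variance $a_1+a_2$, and the surplus is subtracted again in $h_R$. *)
Lemma sum_logpoly (r : seq nat) (q : nat -> K) R w : (3 <= R)%N ->
  let a j := \sum_(k <- r) q k ^+ j in
  \sum_(k <- r) (logpoly K R).[(q k)%:C * w] =
  (a 1%N + a 2%N)%:C * w + chorner (hpoly a R) w.
Proof.
move=> hR a.
have -> : \sum_(k <- r) (logpoly K R).[(q k)%:C * w] =
    \sum_(1 <= j < R.+1) (a j / j%:R)%:C * w ^+ j.
  rewrite big_add1 /= big_mkord.
  under eq_bigr do rewrite horner_logpoly.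
  rewrite exchange_big; apply: eq_bigr => i _ /=.
  rewrite /a rmorphM fmorphV rmorph_nat rmorph_sum !mulr_suml /=.
  by apply: eq_bigr => k _; rewrite exprMn rmorphXn mulrAC.
rewrite big_ltn ?ltnS; last by lia.
rewrite big_ltn; last by lia.
rewrite chornerE expr1 divr1 rmorphD /=; ring.
Qed.

Lemma cmod_hpoly_le a R w : (forall j, (2 <= j)%N -> 0 <= a j <= a 2%N) ->
  cmod w <= 2 ->
  cmod (chorner (hpoly a R) w) <= (2 + R%:R * 2 ^+ R) * (a 2%N * cmod w).
Proof.
move=> ha w2; have /andP[a0 _] := ha 2%N isT.
rewrite chornerE mulrDl; apply: (le_trans (cmodD _ _)); apply: lerD.
  apply: (le_trans (cmodD _ _)); rewrite !cmodM cmodN !cmod_real.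
  rewrite !ger0_norm ?divr_ge0//.
  have := mulr_ge0 (mulr_ge0 a0 (cmod_ge0 w)) (_ : 0 <= 2 - cmod w).
  by rewrite subr_ge0 => /(_ w2); nra.
apply: (le_trans (cmod_sum _ _ _)).
apply: (@le_trans _ _ (\sum_(3 <= r < R.+1) 2 ^+ R * (a 2%N * cmod w))).
  rewrite big_nat [leRHS]big_nat; apply: ler_sum => j /andP[j3 jR].
  have /andP[aj0 aj] := ha j (ltnW j3).
  rewrite cmodM cmodX cmod_real ger0_norm ?divr_ge0//.
  have h1 : a j / j%:R <= a 2%N.
    rewrite ler_pdivrMr ?ltr0n; last by lia.
    by rewrite (le_trans aj)// ler_peMr// ler1n; lia.
  have h2 : cmod w ^+ j <= 2 ^+ R * cmod w.
    rewrite -(prednK (_ : 0 < j)%N); last by lia.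
    rewrite exprSr ler_wpM2r ?cmod_ge0//.
    apply: (@le_trans _ _ (2 ^+ j.-1)); first by rewrite lerXn2r ?nnegrE ?cmod_ge0.
    by rewrite ler_eXn2l ?ltr1n//; lia.
  rewrite [leRHS]mulrCA; apply: ler_pM => //; rewrite ?exprn_ge0 ?cmod_ge0//.
  by rewrite divr_ge0.
rewrite big_const_nat iter_addr addr0 -[leRHS]mulrA -[leLHS]mulr_natl.
rewrite ler_wpM2r ?ler_nat//; last by lia.
by rewrite !mulr_ge0 ?exprn_ge0 ?cmod_ge0.
Qed.

(** [c1] comes from $|h|\le c_1a_2|w|\le 2c_1$ and [c2] from the inverse Weierstrass factors. The
    first summand pays for the product of these factors, the second for the Taylor remainder of
    $e^h$. *)
Definition pointwise_const R : K :=
  let c1 := 2 + R%:R * 2 ^+ R in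
  let c2 := 4 * expR R%:R ^+ 2 in
  expR (2 * c1) * c2 * expR (c2 * 2 ^+ R.+1)
    + 2 * c1 ^+ (3 * R - 1) * expR (4 * c1).

Lemma pointwise_const_gt0 R : 0 < pointwise_const R.
Proof.
apply: ltr_wpDr; first by rewrite !mulr_ge0 ?expR_ge0 ?exprn_ge0 ?addr_ge0 ?mulr_ge0
    ?exprn_ge0.
by rewrite !mulr_gt0 ?expR_gt0 ?exprn_gt0 ?expR_gt0.
Qed.

(** The condition on [complex.Re w] says that $|w+1|=1$; it converts $|\exp((a_1+a_2)w)|$ into
    Gaussian decay. *)
Lemma pointwise_estimate (r : seq nat) (q : nat -> K) R w :
  let a j := \sum_(k <- r) q k ^+ j in
  (3 <= R)%N -> {in r, forall k, 0 <= q k <= 4^-1} -> a 2%N <= 1 ->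
  cmod w <= 2 -> complex.Re w = - (cmod w ^+ 2 / 2) ->
  cmod (\prod_(k <- r) (1 - (q k)%:C * w)^-1 -
        cexp ((a 1%N + a 2%N)%:C * w) * chorner (Hpoly a R) w) <=
  pointwise_const R * expR (- ((a 1%N + a 2%N) * (cmod w ^+ 2 / 2))) *
   (a R.+1 * cmod w ^+ R.+1 + (a 2%N * cmod w) ^+ (3 * R - 1)).
Proof.
move=> a hR hq a21 w2 Rew.
have w0 := cmod_ge0 w.
have a_ge0 j : 0 <= a j.
  rewrite /a big_seq sumr_ge0// => k /hq /andP[q0 _]; exact: exprn_ge0.
have a_mono j : (2 <= j)%N -> 0 <= a j <= a 2%N.
  move=> j2; rewrite a_ge0 /= /a big_seq [leRHS]big_seq ler_sum// => k /hq /andP[q0 q4].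
  by rewrite ler_wiXn2l//; lra.
have ? : a R.+1 <= 1 by have /andP[_ /le_trans] := a_mono R.+1 (ltnW (leqW hR)); apply.
set s2 := a 1%N + a 2%N.
set h := chorner (hpoly a R) w.
pose E k := (weierstrass_factor R ((q k)%:C * w))^-1.
have xB k : k \in r -> cmod ((q k)%:C * w) <= 2^-1.
  move=> /hq /andP[q0 q4]; rewrite cmodM cmod_real ger0_norm//.
  have -> : (2^-1 : K) = 4^-1 * 2 by field.
  exact: ler_pM.
have prodE : \prod_(k <- r) (1 - (q k)%:C * w)^-1 =
    cexp (s2%:C * w) * (cexp h * \prod_(k <- r) E k).
  rewrite mulrA -cexpD -sum_logpoly// cexp_sum -big_split /=.
  apply: eq_bigr => k _.
  by rewrite /E /weierstrass_factor invfM mulrCA mulfV ?mulr1// cexp_neq0.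
rewrite prodE chorner_Hpoly -/h -mulrBr cmodM cmod_cexp ReM /= mul0r subr0 Rew.
rewrite mulrN [leRHS]mulrAC [leRHS]mulrC ler_wpM2l ?expR_ge0//.
pose c1 : K := 2 + R%:R * 2 ^+ R.
pose c2 : K := 4 * expR R%:R ^+ 2.
have c10 : 0 <= c1 by rewrite addr_ge0 ?mulr_ge0 ?exprn_ge0.
have c20 : 0 <= c2 by rewrite mulr_ge0 ?exprn_ge0 ?expR_ge0.
have hB : cmod h <= c1 * (a 2%N * cmod w) by exact: cmod_hpoly_le.
have hB2 : cmod h <= 2 * c1.
  apply: (le_trans hB); rewrite mulrC ler_wpM2r//.
  by rewrite -[leRHS]mul1r ler_pM.
pose B := c2 * (a R.+1 * cmod w ^+ R.+1).
have EB : cmod (\prod_(k <- r) E k - 1) <= B * expR B.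
  pose b k := 4 * expR R%:R ^+ 2 * cmod ((q k)%:C * w) ^+ R.+1.
  have -> : B = \sum_(k <- r) b k.
    rewrite /B /a mulr_suml mulr_sumr big_seq [RHS]big_seq;
        apply: eq_bigr => k /hq /andP[q0 _].
    by rewrite /b cmodM cmod_real ger0_norm// exprMn.
  apply: cmod_prodB1 => k kr; rewrite /b.
    by rewrite !mulr_ge0 ?exprn_ge0 ?expR_ge0 ?cmod_ge0.
  exact/cmod_weierstrass_factorV_B1/xB.
have B0 : 0 <= B by rewrite !mulr_ge0 ?exprn_ge0.
have Bc : B <= c2 * 2 ^+ R.+1.
  rewrite ler_wpM2l// -[leRHS]mul1r ler_pM ?exprn_ge0//.
  by rewrite lerXn2r ?nnegrE.
(* The two error sources are separated here: the tails of the logarithms, of order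
   $a_{R+1}|w|^{R+1}$, and the truncation of $e^h$, of order $(a_2|w|)^{3R-1}$. *)
have -> : cexp h * \prod_(k <- r) E k - (expoly K (3 * R - 2).+1).[h] =
   cexp h * (\prod_(k <- r) E k - 1) + (cexp h - (expoly K (3 * R - 2).+1).[h]) by ring.
apply: (le_trans (cmodD _ _)); rewrite /pointwise_const -/c1 -/c2.
rewrite [leRHS]mulrDr; apply: lerD.
  rewrite cmodM.
  apply: (@le_trans _ _ (expR (2 * c1) * c2 * expR (c2 * 2 ^+ R.+1) * (a R.+1 * cmod w
      ^+ R.+1))).
    have -> : expR (2 * c1) * c2 * expR (c2 * 2 ^+ R.+1) * (a R.+1 * cmod w ^+ R.+1) =
      expR (2 * c1) * (B * expR (c2 * 2 ^+ R.+1)) by rewrite /B; ring.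
    apply: ler_pM; rewrite ?cmod_ge0//.
      by rewrite (le_trans (cmod_cexp_le _))// ler_expR.
    by rewrite (le_trans EB)// ler_wpM2l// ler_expR.
  rewrite ler_wpM2r ?mulr_ge0 ?exprn_ge0// lerDl.
  by rewrite !mulr_ge0 ?expR_ge0 ?exprn_ge0.
apply: (le_trans (cexp_taylor _ _)).
have -> : (3 * R - 2).+1 = (3 * R - 1)%N by lia.
apply: (@le_trans _ _ (2 * c1 ^+ (3 * R - 1) * expR (4 * c1) * (a 2%N * cmod w) ^+ (3 *
    R - 1))).
  rewrite [leRHS](_ : _ = 2 * (c1 * (a 2%N * cmod w)) ^+ (3 * R - 1) * expR (4 * c1));
      last first.
    by rewrite [in RHS]exprMn; ring.
  apply: ler_pM; rewrite ?mulr_ge0 ?exprn_ge0 ?expR_ge0 ?cmod_ge0//.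
    by rewrite ler_wpM2l// lerXn2r ?nnegrE ?mulr_ge0 ?cmod_ge0.
  by rewrite ler_expR; lra.
rewrite ler_wpM2r ?mulr_ge0 ?exprn_ge0 ?mulr_ge0// lerDr.
by rewrite !mulr_ge0 ?expR_ge0 ?exprn_ge0 ?expR_ge0.
Qed.

End PointwiseEstimate.

(** * Replacing the Gaussian factor by a rational one *)

Section GaussianDecay.
Variable K : realType.

(** Put $x=kt$ and raise $t\le e^t$ to the power $k$. *)
Lemma exprn_le_expR (x : K) k : 0 <= x -> x ^+ k <= k%:R ^+ k * expR x.
Proof.
case: k => [|k] x0; first by rewrite !expr0 mul1r -expR0 ler_expR.
have kn : (k.+1%:R : K) != 0 by rewrite pnatr_eq0.
set t := x / k.+1%:R.
have -> : x = k.+1%:R * t by rewrite mulrC divfK.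
rewrite expRM_natl exprMn ler_wpM2l ?exprn_ge0//.
rewrite lerXn2r ?nnegrE ?divr_ge0 ?expR_ge0//.
by apply: le_trans (expR_ge1Dx _); rewrite lerDr.
Qed.

Definition gauss_const p : K := 2 ^+ p.+1 * p.+1%:R ^+ p.+1 * expR 2^-1.

Lemma gauss_const_gt0 p : 0 < gauss_const p.
Proof. by rewrite !mulr_gt0 ?expR_gt0 ?exprn_gt0. Qed.

(** In the variable $Y=sy$ this is $Y^p(1+Y^2)\le C\,e^{Y^2/2}$. The left side is at most
    $(1+Y^2)^{p+1}$, to which the previous power bound applies at $(1+Y^2)/2$; this is the origin of
    [gauss_const]. The factor $(1+Y^2)^{-1}$ is kept because it can be compared with a Poisson
    kernel. *)
Lemma gaussian_decay (s y : K) p : 0 < s -> 0 <= y ->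
  expR (- (s ^+ 2 * (y ^+ 2 / 2))) * y ^+ p <=
  gauss_const p / s ^+ p * (1 + s ^+ 2 * y ^+ 2)^-1.
Proof.
move=> s0 y0; set Y := s * y.
have Y0 : 0 <= Y by rewrite mulr_ge0// ltW.
have -> : s ^+ 2 * y ^+ 2 = Y ^+ 2 by rewrite exprMn.
have -> : s ^+ 2 * (y ^+ 2 / 2) = Y ^+ 2 / 2 by rewrite mulrA exprMn.
have D0 : 0 < 1 + Y ^+ 2 by rewrite ltr_wpDr ?sqr_ge0.
rewrite ler_pdivlMr// ler_pdivlMr ?exprn_gt0// expRN.
have YpE : Y ^+ p = s ^+ p * y ^+ p by rewrite exprMn.
set e := expR _.
rewrite [leLHS](_ : _ = Y ^+ p * (1 + Y ^+ 2) / e); last by rewrite YpE; ring.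
rewrite ler_pdivrMr ?expR_gt0// /e.
apply: (@le_trans _ _ ((1 + Y ^+ 2) ^+ p.+1)).
  rewrite [leRHS]exprSr ler_wpM2r ?(ltW D0)//.
  by rewrite lerXn2r ?nnegrE ?(ltW D0)//; nra.
have h := @exprn_le_expR ((1 + Y ^+ 2) / 2) p.+1 (divr_ge0 (ltW D0) (ler0n _ _)).
rewrite -[1 + _](@divfK _ 2)// mulrC exprMn /gauss_const.
rewrite [leRHS](_ : _ = 2 ^+ p.+1 * (p.+1%:R ^+ p.+1 * (expR 2^-1 * expR (Y ^+ 2 /
    2)))); last by ring.
by rewrite ler_wpM2l ?exprn_ge0// (le_trans h)// mulrDl mul1r expRD.
Qed.

End GaussianDecay.

(** * Fourier inversion by averages over roots of unity *)

Section RootsOfUnity.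
Variable K : realType.

Definition angle (Q l : nat) : K := 2 * pi * l%:R / Q%:R.

Lemma expi_angle Q l : expi (angle Q l) = expi (angle Q 1) ^+ l.
Proof. by rewrite -expiMn /angle mulr1 mulrAC. Qed.

Lemma expi2pi : expi (2 * pi : K) = 1.
Proof. by rewrite /expi mulr_natl -[pi *+ 2]add0r cosD2pi sinD2pi cos0 sin0. Qed.

Lemma expi_angleXQ Q l : (0 < Q)%N -> expi (angle Q l) ^+ Q = 1.
Proof.
move=> Q0; rewrite expi_angle exprAC -expiMn /angle mulr1 mulfVK ?pnatr_eq0 -?lt0n//.
by rewrite expi2pi expr1n.
Qed.

Lemma expi_neq1 (t : K) : 0 < t -> t < 2 * pi -> expi t != 1.
Proof.
move=> t0 t2; apply/eqP => e1.
have := sqr_cmod_expiB1 t; rewrite e1 subrr cmod0 expr0n /=.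
have -> : cos t = 1 - 2 * sin (t / 2) ^+ 2.
  have -> : cos t = cos (t / 2 + t / 2) by congr cos; lra.
  rewrite cosD -!expr2 cos2sin2; ring.
have : 0 < sin (t / 2) by apply: sin_gt0_pi; apply/andP; split; lra.
nra.
Qed.

Lemma sum_expi_angle Q j : (0 < Q)%N ->
  \sum_(l < Q) expi (angle Q l) ^+ j = if (Q %| j)%N then Q%:R else 0.
Proof.
move=> Q0; case: ifPn => [/dvdnP[c ->]|Qj].
  rewrite (eq_bigr (fun=> 1)) ?sumr_const ?card_ord// => l _.
  by rewrite mulnC exprM expi_angleXQ// expr1n.
set x := expi (angle Q 1) ^+ j.
have -> : \sum_(l < Q) expi (angle Q l) ^+ j = \sum_(l < Q) x ^+ l.
  by apply: eq_bigr => l _; rewrite expi_angle exprAC.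
have x1 : x - 1 != 0.
  rewrite subr_eq0 /x (divn_eq j Q) exprD mulnC exprM expi_angleXQ// expr1n mul1r.
  rewrite -expi_angle; apply: expi_neq1; rewrite /angle.
    by rewrite divr_gt0 ?ltr0n// !mulr_gt0 ?pi_gt0// ltr0n lt0n.
  rewrite ltr_pdivrMr ?ltr0n// ltr_pM2l ?ltr_nat ?ltn_mod//.
  by rewrite mulr_gt0 ?pi_gt0.
apply: (mulfI x1); rewrite -subrX1 mulr0 /x exprAC expi_angleXQ// expr1n.
by rewrite subrr.
Qed.

Definition trig_sum (d : nat -> K) N (t : K) : K[i] :=
  \sum_(j < N) (d j)%:C * expi t ^+ j.

(** Discrete inversion recovers [d k] only up to aliasing, that is, up to the coefficients whose
    index is congruent to [k] modulo [Q]; these all have index at least [Q] and are bounded by the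
    tail sum. *)
Lemma coef_le_average (d : nat -> K) N Q k : (k < Q)%N -> (Q <= N)%N ->
  `|d k| <= (\sum_(l < Q) cmod (trig_sum d N (angle Q l))) / Q%:R
            + \sum_(Q <= j < N) `|d j|.
Proof.
move=> kQ QN; have Q0 : (0 < Q)%N by exact: leq_ltn_trans kQ.
have Qp : 0 < (Q%:R : K) by rewrite ltr0n.
pose S : K := \sum_(Q <= j < N) if (Q %| j + (Q - k))%N then d j else 0.
(* On [Q]-th roots of unity $z^{Q-k}=z^{-k}$; this form keeps the exponents natural numbers. *)
have E : \sum_(l < Q) expi (angle Q l) ^+ (Q - k) * trig_sum d N (angle Q l)
    = (Q%:R * (d k + S))%:C.
  transitivity (\sum_(j < N) (Q%:R * (if (Q %| j + (Q - k))%N then d j else 0))%:C).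
    under eq_bigr do rewrite mulr_sumr.
    rewrite exchange_big; apply: eq_bigr => j _ /=.
    rewrite (eq_bigr (fun l : 'I_Q => (d j)%:C * expi (angle Q l) ^+ (j + (Q - k))));
        last first.
      by move=> l _; rewrite mulrCA -exprD addnC.
    rewrite -mulr_sumr sum_expi_angle//; case: ifP => _; last by rewrite !mulr0.
    by rewrite rmorphM rmorph_nat mulrC.
  rewrite -rmorph_sum -mulr_sumr /=; congr ((_ * _)%:C).
  rewrite -(big_mkord xpredT (fun j => if (Q %| j + (Q - k))%N then d j else 0)).
  rewrite (@big_cat_nat _ _ _ Q)//=; congr (_ + _).
  rewrite big_mkord (bigD1 (Ordinal kQ))//= subnKC ?dvdnn ?(ltnW kQ)//.
  rewrite big1 ?addr0// => i ik; rewrite ifF//; apply/negbTE/negP => /dvdnP[c hc].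
  have iQ := ltn_ord i.
  have : c = 1%N by nia.
  move=> c1; move: ik; apply/negP; rewrite negbK; apply/eqP/val_inj => /=.
  by move: hc; rewrite c1; lia.
have dS : d k = (d k + S) - S by rewrite addrK.
rewrite dS; apply: (le_trans (ler_normB _ _)); apply: lerD.
  rewrite ler_pdivlMr// mulrC -[X in X * _]normr_nat -normrM -cmod_real -E.
  apply: (le_trans (cmod_sum _ _ _)); apply: ler_sum => l _.
  by rewrite cmodM cmodX cmod_expi expr1n mul1r.
apply: (le_trans (ler_norm_sum _ _ _)); apply: ler_sum => j _.
by case: ifP => // _; rewrite normr0.
Qed.

(** If $z^Q=1$ then $(1-\rho z)^{-1}=(1-\rho^Q)^{-1}\sum_{j<Q}\rho^jz^j$ exactly, and summation over
    the roots keeps only $j=0$. *)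
Lemma sum_poisson Q (rho : K) : (0 < Q)%N -> 0 <= rho < 1 ->
  \sum_(l < Q) complex.Re (1 - rho%:C * expi (angle Q l))^-1 = Q%:R / (1 - rho ^+ Q).
Proof.
move=> Q0 /andP[r0 r1].
have rQ : rho ^+ Q < 1 by rewrite exprn_ilt1// -lt0n.
have E (l : 'I_Q) : (1 - rho%:C * expi (angle Q l))^-1 =
   (\sum_(j < Q) (rho ^+ j)%:C * expi (angle Q l) ^+ j) * ((1 - rho ^+ Q)^-1)%:C.
  set x := rho%:C * _.
  have xQ : x ^+ Q = (rho ^+ Q)%:C by rewrite /x exprMn expi_angleXQ// mulr1 rmorphXn.
  have n1 : (1 - rho ^+ Q)%:C != 0 by rewrite -(rmorph0 (real_complex K)) (inj_eq
      (@complexI K)) subr_eq0 gt_eqF.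
  have n2 : 1 - x != 0.
    apply/eqP => /subr0_eq x1; move: n1; rewrite rmorphB /= -xQ -x1 expr1n subrr.
    by rewrite eqxx.
  apply: (mulfI n2); rewrite mulfV// mulrA.
  have -> : (1 - x) * (\sum_(j < Q) (rho ^+ j)%:C * expi (angle Q l) ^+ j) = 1 - x ^+ Q.
    transitivity ((1 - x) * \sum_(j < Q) x ^+ j).
      by congr (_ * _); apply: eq_bigr => j _; rewrite exprMn rmorphXn.
    by rewrite -(opprB x 1) mulNr -subrX1 opprB.
  by rewrite xQ -(rmorph1 (real_complex K)) -rmorphB -rmorphM /= mulfV// subr_eq0 gt_eqF.
rewrite -raddf_sum /= (eq_bigr _ (fun l _ => E l)) -mulr_suml exchange_big /=.
under eq_bigr do rewrite -mulr_sumr sum_expi_angle//.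
rewrite (bigD1 (Ordinal Q0))//= dvdn0 expr0 mul1r big1; last first.
  move=> j j0; rewrite ifF ?mulr0//; apply/negbTE/negP => /(dvdn_leq _).
  by rewrite lt0n => /(_ j0); rewrite leqNgt ltn_ord.
by rewrite addr0 -(rmorph_nat (real_complex K)) -rmorphM.
Qed.

Lemma Re_inv (u : K[i]) : complex.Re u^-1 = complex.Re u / cmod u ^+ 2.
Proof. by rewrite sqr_cmod; case: u. Qed.

(* With [rho = s^2 / (1 + s)^2] the summand is dominated by a multiple of the
   Poisson kernel [(1 - rho^2) / |1 - rho z|^2], whose average over the [Q]-th
   roots of unity is [(1 + rho^Q) / (1 - rho^Q)]. *)
Lemma average_le (s : K) : 0 < s -> exists Q0, forall Q, (Q0 <= Q)%N -> (0 < Q)%N ->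
  (\sum_(l < Q) (1 + s ^+ 2 * cmod (expi (angle Q l) - 1) ^+ 2)^-1) / Q%:R <= 6 / s.
Proof.
move=> s0.
pose rho := s ^+ 2 / (1 + s) ^+ 2.
have s1 : 0 < 1 + s by rewrite addr_gt0.
have rE : 1 - rho = (1 + 2 * s) / (1 + s) ^+ 2.
  by rewrite /rho; field; rewrite gt_eqF.
have r0 : 0 <= rho by rewrite divr_ge0 ?sqr_ge0.
have r1 : 0 < 1 - rho by rewrite rE divr_gt0 ?exprn_gt0// ltr_wpDr// mulr_ge0// ltW.
have rs : 1 - rho <= 2 / s.
  rewrite rE ler_pdivrMr ?exprn_gt0// mulrAC ler_pdivlMr//; nra.
(* This is what the choice of [rho] is for: since $|1-\rho z|^2=(1-\rho)^2+\rho|z-1|^2$, it yields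
   $|1-\rho z|^2\le(1-\rho)^2(1+s^2|z-1|^2)$. *)
have rr : rho <= (1 - rho) ^+ 2 * s ^+ 2.
  have rho2 : rho = (s / (1 + s)) ^+ 2 by rewrite expr_div_n.
  rewrite [leLHS]rho2 -exprMn.
  rewrite lerXn2r ?nnegrE ?divr_ge0 ?mulr_ge0 ?(ltW s0) ?(ltW s1) ?(ltW r1)//.
  rewrite -subr_ge0 rE (_ : _ - _ = s ^+ 2 / (1 + s) ^+ 2).
    by rewrite divr_ge0 ?sqr_ge0.
  by field; rewrite gt_eqF.
have [Q0 _ hQ0] : exists2 Q0, True & forall Q, (Q0 <= Q)%N -> rho ^+ Q <= 2^-1.
  have h : `|rho| < 1 by rewrite ger0_norm// -subr_gt0.
  have /cvgrPdist_le/(_ 2^-1) := @cvg_expr K rho h.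
  rewrite invr_gt0 ltr0n => /(_ isT) [Q0 _ hQ0]; exists Q0 => // Q /hQ0 /=.
  by rewrite sub0r normrN ger0_norm ?exprn_ge0.
exists Q0 => Q /hQ0 hQ Qp.
have Qr : 0 < (Q%:R : K) by rewrite ltr0n.
rewrite ler_pdivrMr//.
apply: (@le_trans _ _ (\sum_(l < Q) (1 - rho) *
    (2 * complex.Re (1 - rho%:C * expi (angle Q l))^-1 - 1))).
  apply: ler_sum => l _; set z := expi _.
  have z1 : complex.Re z ^+ 2 + complex.Im z ^+ 2 = 1.
    by rewrite -sqr_cmod cmod_expi expr1n.
  have w1 : cmod (z - 1) ^+ 2 = 2 * (1 - complex.Re z) by rewrite sqr_cmod_expiB1.
  have v1 : cmod (1 - rho%:C * z) ^+ 2 = (1 - rho) ^+ 2 + rho * cmod (z - 1) ^+ 2.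
    rewrite w1 sqr_cmod; case: z z1 {w1} => x y /= z1.
    transitivity ((1 - rho * x) ^+ 2 + rho ^+ 2 * y ^+ 2); first by ring.
    have -> : y ^+ 2 = 1 - x ^+ 2 by rewrite -z1; ring.
    ring.
  have W0 : 0 <= cmod (z - 1) ^+ 2 by rewrite sqr_ge0.
  set W := cmod (z - 1) ^+ 2 in w1 v1 W0 *; set V := cmod _ ^+ 2 in v1.
  have V0 : 0 < V by rewrite v1 ltr_pwDl ?exprn_gt0// mulr_ge0.
  have -> : 2 * complex.Re (1 - rho%:C * z)^-1 - 1 = (1 - rho ^+ 2) / V.
    rewrite Re_inv -/V [complex.Re _](_ : _ = 1 - rho * complex.Re z); last first.
      by case: z {z1 W w1 v1 W0 V V0} => x y /=; rewrite mul0r subr0.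
    have -> : 1 - rho ^+ 2 = 2 * (1 - rho * complex.Re z) - V by rewrite v1 w1; ring.
    by field; rewrite gt_eqF.
  rewrite mulrA ler_pdivlMr// mulrC ler_pdivrMr;
      last by rewrite ltr_pwDl// mulr_ge0 ?sqr_ge0.
  apply: (@le_trans _ _ ((1 - rho) ^+ 2 * (1 + s ^+ 2 * W))).
    rewrite v1 [leRHS](_ : _ = (1 - rho) ^+ 2 + (1 - rho) ^+ 2 * s ^+ 2 * W); last by ring.
    by rewrite lerD2l ler_wpM2r.
  rewrite ler_wpM2r ?addr_ge0 ?mulr_ge0 ?exprn_ge0 ?(ltW s0) ?cmod_ge0//.
  rewrite -subr_ge0 (_ : _ - _ = (1 - rho) ^+ 2 * rho); last by ring.
  by rewrite mulr_ge0 ?sqr_ge0.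
rewrite -mulr_sumr sumrB -mulr_sumr sum_poisson//; last by rewrite r0 -subr_gt0.
rewrite sumr_const card_ord.
(* From $\rho^Q\le1/2$. The average of $2\,\mathrm{Re}(1-\rho z)^{-1}-1$ is then at most 3, and
   $1-\rho\le2/s$ produces the constant 6. *)
have h2 : Q%:R / (1 - rho ^+ Q) <= 2 * Q%:R.
  by rewrite ler_pdivrMr; [nra | lra].
apply: (@le_trans _ _ ((1 - rho) * (3 * Q%:R))).
  by rewrite ler_wpM2l ?(ltW r1)//; lra.
have -> : 6 / s * Q%:R = 2 / s * (3 * Q%:R) by field; rewrite gt_eqF.
by rewrite ler_wpM2r.
Qed.

(** Absolute summability makes the aliasing error vanish as [Q] grows, so the bound on the averages
    passes to the coefficients without any integral. *)
Lemma inversion_bound (d : nat -> K) (Phi : K -> K[i]) (s A S : K) :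
  0 < s -> 0 <= A ->
  (forall N, \sum_(j < N) `|d j| <= S) ->
  (forall t e, 0 < e -> exists N0, forall N, (N0 <= N)%N ->
    cmod (Phi t - trig_sum d N t) <= e) ->
  (forall t, cmod (Phi t) <= A / (1 + s ^+ 2 * cmod (expi t - 1) ^+ 2)) ->
  forall k, `|d k| <= A * (6 / s).
Proof.
move=> s0 A0 dS dPhi PhiA k; apply/ler_addgt0Pr => e e0.
have e2 : 0 < e / 2 by rewrite divr_gt0.
have [Q1 hQ1] : exists Q1, forall Q N, (Q1 <= Q)%N -> (Q <= N)%N ->
    \sum_(Q <= j < N) `|d j| <= e / 2.
  pose u N := \sum_(0 <= j < N) `|d j|.
  have uS N : u N <= S by rewrite /u big_mkord.
  have und : nondecreasing_seq u.
    apply/nondecreasing_seqP => N; rewrite /u big_nat_recr//= lerDl//.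
  have ub : has_ubound (range u) by exists S => _ [N _ <-].
  have := nondecreasing_cvgn und ub.
  move=> /cvgrPdist_le/(_ _ e2)[Q1 _ hQ1]; exists Q1 => Q N hQ QN.
  have : u N - u Q = \sum_(Q <= j < N) `|d j|.
    by rewrite /u (big_cat_nat (n := Q))//= addrAC subrr add0r.
  move=> <-; have /= := hQ1 Q hQ; have := nondecreasing_cvgn_le und (cvgP _
      (nondecreasing_cvgn und ub)) N.
  rewrite (cvg_lim _ (nondecreasing_cvgn und ub))// => h1 h2.
  have := le_trans (ler_norm _) h2; lra.
have [Q2 hQ2] := average_le s0.
pose Q := maxn (maxn Q1 Q2) k.+1.
have Q0 : (0 < Q)%N by rewrite /Q; lia.
have Qr : 0 < (Q%:R : K) by rewrite ltr0n.
(* [N] is chosen after [Q]: only finitely many angles are sampled, so pointwise convergence of the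
   trigonometric sums is enough. *)
have [N [QN hN]] : exists N, (Q <= N)%N /\
    forall l, (l < Q)%N -> cmod (Phi (angle Q l) - trig_sum d N (angle Q l)) <= e / 2.
  have [N hN] : exists N, forall M, (N <= M)%N -> forall l, (l < Q)%N ->
      cmod (Phi (angle Q l) - trig_sum d M (angle Q l)) <= e / 2.
    elim: {1}Q => [|q [N IH]]; first by exists 0%N.
    have [N0 hN0] := dPhi (angle Q q) _ e2.
    exists (maxn N N0) => M; rewrite geq_max => /andP[NM N0M] l.
    rewrite ltnS leq_eqVlt => /orP[/eqP->|]; [exact: hN0 | exact: IH].
  by exists (maxn N Q); split; [lia | apply: hN; lia].
have kQ : (k < Q)%N by rewrite /Q; lia.
apply: (le_trans (coef_le_average d kQ QN)).
have -> : A * (6 / s) + e = (A * (6 / s) + e / 2) + e / 2 by lra.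
apply: lerD; last by apply: hQ1 => //; rewrite /Q; lia.
apply: (@le_trans _ _ ((\sum_(l < Q) (A * (1 + s ^+ 2 * cmod (expi (angle Q l) - 1) ^+
    2)^-1 + e / 2)) / Q%:R)).
  rewrite ler_wpM2r ?invr_ge0//; apply: ler_sum => l _.
  have -> : trig_sum d N (angle Q l) = Phi (angle Q l) - (Phi (angle Q l) - trig_sum d
      N (angle Q l)) by rewrite subKr.
  by apply: (le_trans (cmodB _ _)); apply: lerD; [exact: PhiA | apply: hN].
rewrite big_split /= sumr_const card_ord -mulr_sumr mulrDl -mulrA; apply: lerD.
  by rewrite ler_wpM2l// hQ2// /Q; lia.
by rewrite -[_ *+ Q]mulr_natr mulfK// gt_eqF.
Qed.

End RootsOfUnity.

(** * Counting draw sequences by their number of distinct coupons *)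

Section CouponCounts.
Variable n : nat.

(** This number is $S(t,j)\,n(n-1)\cdots(n-j+1)$ with $S$ the Stirling numbers of the second kind;
    only its recurrence is used. *)
Definition count_distinct t j : nat :=
  \sum_(s : t.-tuple 'I_n) (size (undup s) == j).

Lemma card_undup (s : seq 'I_n) : #|[pred a | a \in s]| = size (undup s).
Proof.
rewrite -(card_uniqP (undup_uniq s)); apply: eq_card => a.
by rewrite !inE mem_undup.
Qed.

Lemma card_notin (s : seq 'I_n) : #|[pred a | a \notin s]| = (n - size (undup s))%N.
Proof.
have := cardC [pred a | a \in s]; rewrite card_ord card_undup => h.
rewrite -(eq_card (_ : [predC [pred a | a \in s]] =i _)); last by move=> a; rewrite !inE.
have le : (size (undup s) <= n)%N.
  by have := leq_addr #|[predC [pred a | a \in s]]| (size (undup s)); rewrite h.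
by apply: (@addnI (size (undup s))); rewrite h subnKC.
Qed.

Lemma big_tuple_cons (T : nmodType) t (F : t.+1.-tuple 'I_n -> T) :
  \sum_(x : t.+1.-tuple 'I_n) F x =
  \sum_(s : t.-tuple 'I_n) \sum_(a : 'I_n) F [tuple of a :: s].
Proof.
rewrite pair_big (reindex (fun p : t.-tuple 'I_n * 'I_n => [tuple of p.2 :: p.1])) //=.
exists (fun x : t.+1.-tuple 'I_n => ([tuple of behead x], thead x)) => [[s a]|x] _ /=.
  by congr (_, _); apply/val_inj.
by apply/val_inj => /=; rewrite [in RHS](tuple_eta x).
Qed.

(** A further draw either repeats one of the coupons already seen or is one of the [n - j] new
    ones. *)
Lemma sum_undup_cons (s : seq 'I_n) j :
  (\sum_(a : 'I_n) (size (undup (a :: s)) == j.+1) =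
   (size (undup s) == j.+1) * j.+1 + (size (undup s) == j) * (n - j))%N.
Proof.
rewrite (bigID (fun a => a \in s)) /=.
rewrite (eq_bigr (fun=> (size (undup s) == j.+1) : nat)); last by move=> a ->.
rewrite sum_nat_const card_undup mulnC.
rewrite [X in (_ + X)%N](eq_bigr (fun=> (size (undup s) == j) : nat)); last first.
  by move=> a /negbTE ->.
rewrite sum_nat_const [X in (_ + X)%N]mulnC; congr (_ + _)%N.
  by case: eqP => [->|].
case: eqP => [<-|//]; rewrite !mul1n -card_notin.
by apply: eq_card => a; rewrite !inE.
Qed.

Lemma count_distinctS t j :
  count_distinct t.+1 j.+1 =
  (j.+1 * count_distinct t j.+1 + (n - j) * count_distinct t j)%N.
Proof.
rewrite /count_distinct big_tuple_cons /=.
under eq_bigr do rewrite sum_undup_cons.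
by rewrite big_split /= -!big_distrl /= ![(_ * (\sum_(_ | _) _))%N]mulnC.
Qed.

Lemma count_distinct_S0 t : count_distinct t.+1 0 = 0%N.
Proof.
rewrite /count_distinct big1// => s _; case: s => -[//|a s] hs.
apply/eqP; rewrite eqb0 size_eq0 -size_eq0 -lt0n; apply/negP => h.
have : a \in undup (a :: s) by rewrite mem_undup mem_head.
by move: h; case: (undup _).
Qed.

Lemma count_distinct00 : count_distinct 0 0 = 1%N.
Proof.
rewrite /count_distinct (eq_bigr (fun=> 1%N)); last first.
  by move=> s _; rewrite tuple0.
by rewrite sum1_card card_tuple expn0.
Qed.

Lemma count_distinct_gt t j : (t < j)%N -> count_distinct t j = 0%N.
Proof.
move=> tj; rewrite /count_distinct big1// => s _; apply/eqP; rewrite eqb0.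
by rewrite neq_ltn (leq_ltn_trans (size_undup s))// size_tuple.
Qed.

(* A draw sequence of length [t + 1], latest draw first, whose last draw
   completes a collection of [j + 1] distinct coupons. *)
Lemma sum_completing t j :
  (\sum_(x : t.+1.-tuple 'I_n)
     ((j < size (undup x)) && (size (undup (behead x)) <= j)) =
   (n - j) * count_distinct t j)%N.
Proof.
rewrite big_tuple_cons /count_distinct mulnC big_distrl /=; apply: eq_bigr => s _.
transitivity (\sum_(a : 'I_n) ((size (undup s) == j) && (a \notin s)) : nat)%N.
  apply: eq_bigr => a _ /=; case: ifP => as' /=; first by rewrite andbF ltnNge andNb.
  by rewrite ltnS andbT -eqn_leq eq_sym.
case: eqP => [<-|_] /=; last by rewrite big1.
rewrite mul1n -card_notin -sum1_card [RHS]big_mkcond; apply: eq_bigr => a _ /=.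
by rewrite inE; case: (a \notin s).
Qed.

End CouponCounts.

(** * Generating functions of these counts *)

Section CouponSeries.
Variables (K : realType) (n : nat).

(** Probability that [j + k] draws show exactly [j] distinct coupons. Indexing by the number [k] of
    repetitions matches the shift of the waiting time by [n - m]. *)
Definition collect_prob (j k : nat) : K :=
  (count_distinct n (j + k) j)%:R / n%:R ^+ (j + k).

Hypothesis n0 : (0 < n)%N.

Let nK : (n%:R : K) != 0. Proof. by rewrite pnatr_eq0 -lt0n. Qed.

Lemma collect_prob_ge0 j k : 0 <= collect_prob j k.
Proof. by rewrite divr_ge0 ?exprn_ge0. Qed.

Lemma collect_prob00 : collect_prob 0 0 = 1.
Proof. by rewrite /collect_prob addn0 count_distinct00 expr0 divr1. Qed.

Lemma collect_prob0S k : collect_prob 0 k.+1 = 0.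
Proof. by rewrite /collect_prob add0n count_distinct_S0 mul0r. Qed.

Lemma collect_probS0 j :
  collect_prob j.+1 0 = (n - j)%:R / n%:R * collect_prob j 0.
Proof.
rewrite /collect_prob !addn0 count_distinctS (@count_distinct_gt n j j.+1)//.
by rewrite muln0 add0n natrM exprS invfM mulrACA.
Qed.

Lemma collect_probSS j k : collect_prob j.+1 k.+1 =
  (n - j)%:R / n%:R * collect_prob j k.+1 + j.+1%:R / n%:R * collect_prob j.+1 k.
Proof.
rewrite /collect_prob addSn count_distinctS -addSnnS natrD !natrM exprS invfM.
rewrite mulrDl addrC; congr (_ + _); by rewrite mulrACA.
Qed.

(** Truncated form of $G_{j+1}=\frac{n-j}nG_j+\frac{j+1}n\,zG_{j+1}$. The factor $z$ shifts the
    index, so the last sum has one term fewer. *)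
Lemma sum_collect_prob (z : K[i]) j L :
  \sum_(k < L.+1) (collect_prob j.+1 k)%:C * z ^+ k =
  ((n - j)%:R / n%:R)%:C * \sum_(k < L.+1) (collect_prob j k)%:C * z ^+ k
  + (j.+1%:R / n%:R)%:C * z * \sum_(k < L) (collect_prob j.+1 k)%:C * z ^+ k.
Proof.
rewrite big_ord_recl [in RHS]big_ord_recl /= !expr0 !mulr1 collect_probS0 rmorphM /=.
rewrite [in RHS]mulrDr -addrA; congr (_ + _).
rewrite !mulr_sumr -big_split /=; apply: eq_bigr => k _.
rewrite /bump add1n collect_probSS rmorphD !rmorphM /= exprS; ring.
Qed.

(** At $z=1$ the truncated recurrence bounds the partial sums of [j.+1] by a constant plus
    $\frac{j+1}n$ times themselves; this ratio is below 1, so the sums can be absorbed. *)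
Lemma collect_prob_bounded j : (j < n)%N ->
  exists S, forall L, \sum_(k < L) collect_prob j k <= S.
Proof.
elim: j => [_|j IH jn].
  exists 1 => L; case: L => [|L]; first by rewrite big_ord0.
  rewrite big_ord_recl collect_prob00 big1 ?addr0// => k _.
  by rewrite lift0 collect_prob0S.
have [S hS] := IH (ltnW jn).
exists ((n - j)%:R / n%:R * S / (1 - j.+1%:R / n%:R)) => L.
have c1 : j.+1%:R / n%:R < 1 :> K by rewrite ltr_pdivrMr ?ltr0n// mul1r ltr_nat.
have mono : \sum_(k < L) collect_prob j.+1 k <= \sum_(k < L.+1) collect_prob j.+1 k.
  by rewrite [leRHS]big_ord_recr /= lerDl collect_prob_ge0.
apply: (le_trans mono).
have E : \sum_(k < L.+1) collect_prob j.+1 k =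
    (n - j)%:R / n%:R * \sum_(k < L.+1) collect_prob j k
    + j.+1%:R / n%:R * \sum_(k < L) collect_prob j.+1 k.
  have S1 i M : \sum_(k < M) (collect_prob i k)%:C * 1 ^+ k =
      (\sum_(k < M) collect_prob i k)%:C.
    by rewrite rmorph_sum; apply: eq_bigr => k _; rewrite expr1n mulr1.
  apply: complexI; have := sum_collect_prob 1 j L; rewrite !S1 => ->.
  by rewrite mulr1 rmorphD !rmorphM.
rewrite ler_pdivlMr ?subr_gt0// mulrBr mulr1 lerBlDr.
rewrite {1}E; apply: lerD; first by rewrite ler_wpM2l ?divr_ge0.
by rewrite mulrC ler_wpM2r ?divr_ge0.
Qed.

Lemma bounded_series_cvg0 (f : nat -> K) S e : (forall k, 0 <= f k) ->
  (forall L, \sum_(k < L) f k <= S) -> 0 < e ->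
  exists N0, forall L, (N0 <= L)%N -> f L <= e.
Proof.
move=> f0 fS e0.
have nd : nondecreasing_seq (series f).
  by apply/nondecreasing_seqP => L; rewrite /series /= big_nat_recr//= lerDl.
have ub : has_ubound (range (series f)).
  by exists S => _ [L _ <-]; rewrite /series /= big_mkord.
have /cvg_series_cvg_0 /cvgrPdist_le/(_ _ e0)[N0 _ hN0] := cvgP _ (nondecreasing_cvgn
    nd ub).
exists N0 => L /hN0 /=; rewrite sub0r normrN; exact: le_trans (ler_norm _).
Qed.

Lemma collect_prob_cvg j (z : K[i]) e : (j < n)%N -> cmod z = 1 -> 0 < e ->
  exists N0, forall L, (N0 <= L)%N ->
    cmod (\prod_(i < j) (((n - i)%:R / n%:R)%:C / (1 - (i.+1%:R / n%:R)%:C * z))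
          - \sum_(k < L) (collect_prob j k)%:C * z ^+ k) <= e.
Proof.
move=> + z1; elim: j e => [|j IH] e jn e0.
  exists 1%N => -[//|L] _; rewrite big_ord0 big_ord_recl collect_prob00 expr0 mulr1.
  rewrite big1 ?addr0 ?subrr ?cmod0 ?ltW// => k _.
  by rewrite lift0 collect_prob0S mul0r.
have c1 : j.+1%:R / n%:R < 1 :> K by rewrite ltr_pdivrMr ?ltr0n// mul1r ltr_nat.
have e1 : 0 < e * (1 - j.+1%:R / n%:R) / 2 by rewrite divr_gt0// mulr_gt0// subr_gt0.
have [S hS] := collect_prob_bounded jn.
have [N1 hN1] := bounded_series_cvg0 (collect_prob_ge0 j.+1) hS e1.
have [N2 hN2] := IH _ (ltnW jn) e1.
exists (maxn N1 N2).+1 => -[//|L]; rewrite ltnS geq_max => /andP[N1L N2L].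
have := hN2 L.+1 (leqW N2L); have := hN1 L N1L.
rewrite [\prod_(_ < _.+1) _]big_ord_recr /=; set G := \prod_(_ < _) _;
    set c := j.+1%:R / n%:R in c1 e1 *.
set b := (n - j)%:R / n%:R.
set s0 := \sum_(k < L.+1) (collect_prob j k)%:C * z ^+ k.
set s1 := \sum_(k < L.+1) (collect_prob j.+1 k)%:C * z ^+ k => fL GL.
have c0 : 0 <= c by rewrite divr_ge0.
have b0 : 0 <= b by rewrite divr_ge0.
have b1 : b <= 1 by rewrite ler_pdivrMr ?ltr0n// mul1r ler_nat leq_subr.
have lb : 1 - c <= cmod (1 - c%:C * z).
  have := cmodD (1 - c%:C * z) (c%:C * z).
  by rewrite subrK cmod1 cmodM cmod_real ger0_norm// z1 mulr1 lerBlDr.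
have nz : 1 - c%:C * z != 0.
  by rewrite -cmod_eq0 gt_eqF// (lt_le_trans _ lb)// subr_gt0.
(* The error for [j.+1], multiplied by $1-cz$, is $b$ times the error for [j] plus one boundary term
   from the truncation. On the unit circle $|1-cz|\ge1-c>0$, and the boundary term tends to 0
   because the series converges. *)
have E : (1 - c%:C * z) * (G * (b%:C / (1 - c%:C * z)) - s1) =
   b%:C * (G - s0) + c%:C * (collect_prob j.+1 L)%:C * z ^+ L.+1.
  have := sum_collect_prob z j L; rewrite -/s1 -/s0 -/b -/c => Es.
  have -> : (1 - c%:C * z) * (G * (b%:C / (1 - c%:C * z)) - s1) =
     G * b%:C * ((1 - c%:C * z) / (1 - c%:C * z)) - (s1 - c%:C * z * s1) by ring.
  rewrite mulfV// mulr1.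
  have s1r : s1 = \sum_(k < L) (collect_prob j.+1 k)%:C * z ^+ k
      + (collect_prob j.+1 L)%:C * z ^+ L by rewrite /s1 big_ord_recr.
  have -> : s1 - c%:C * z * s1 = b%:C * s0 - c%:C * (collect_prob j.+1 L)%:C * z ^+ L.+1.
    by rewrite [X in X - _]Es s1r exprS; ring.
  ring.
rewrite -(ler_pM2l (_ : 0 < 1 - c)) ?subr_gt0//.
apply: (@le_trans _ _ (cmod (1 - c%:C * z) * cmod (G * (b%:C / (1 - c%:C * z)) - s1))).
  by rewrite ler_wpM2r ?cmod_ge0.
rewrite -cmodM E; apply: (le_trans (cmodD _ _)).
rewrite [cmod (b%:C * _)]cmodM [cmod (_ * z ^+ _)]cmodM cmodX z1 expr1n mulr1 cmodM
    !cmod_real !ger0_norm ?collect_prob_ge0//.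
have -> : (1 - c) * e = 1 * (e * (1 - c) / 2) + 1 * (e * (1 - c) / 2) by lra.
by apply: lerD; apply: ler_pM; rewrite ?cmod_ge0 ?collect_prob_ge0// ltW.
Qed.

End CouponSeries.

(** * The law of the waiting time expressed by the counts *)

Section WaitingTimeLaw.
Variables (K : realType) (n : nat) (d : measure_display) (T : measurableType d).
Variables (P : probability T K) (X : nat -> T -> 'I_n).
Hypotheses (n0 : (0 < n)%N) (XP : uniform_draws P X).

(* The first [t] draws, latest first. *)
Definition past t w : t.-tuple 'I_n := [tuple of [seq X i w | i <- rev (iota 0 t)]].

Lemma pastS t w : past t.+1 w = [tuple of X t w :: past t w].
Proof.
apply/val_inj; rewrite -[LHS]/[seq X i w | i <- rev (iota 0 t.+1)].
have -> : iota 0 t.+1 = iota 0 t ++ [:: t] by rewrite -addn1 iotaD.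
by rewrite rev_cat.
Qed.

Lemma num_collected_past t w : num_collected X t w = size (undup (past t w)).
Proof.
apply/perm_size/uniq_perm; rewrite ?undup_uniq// => a.
rewrite !mem_undup /= map_rev mem_rev; congr (a \in _).
Qed.

(** A finite intersection of single-draw events, to which independence applies; the index [t - i.+1]
    undoes the reversal. *)
Lemma past_eqE t (x : t.-tuple 'I_n) : [set w | past t w = x] =
  \bigcap_(i in [set` iota 0 t])
    (X i @^-1` [set nth (Ordinal n0) x (t - i.+1)]).
Proof.
have np w i : (i < t)%N -> nth (Ordinal n0) (past t w) (t - i.+1) = X i w.
  move=> it; have ti : (t - i.+1 < t)%N by lia.
  rewrite /= (nth_map 0%N) ?size_rev ?size_iota// nth_rev ?size_iota// nth_iota;
      last by lia.
  by congr (X _ w); lia.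
apply/seteqP; split => w /=.
  by move=> <- i /=; rewrite mem_iota add0n => /np ->.
move=> h; apply/val_inj/(@eq_from_nth _ (Ordinal n0)); rewrite ?size_tuple// => i it.
have ti : (t - i.+1 < t)%N by lia.
have := h (t - i.+1)%N; rewrite /= mem_iota add0n ti => /(_ isT).
have -> : i = (t - (t - i.+1).+1)%N by lia.
rewrite np//; have -> // : (t - (t - (t - i.+1).+1).+1 = t - i.+1)%N by lia.
Qed.

Lemma measurable_past_eq t (x : t.-tuple 'I_n) : measurable [set w | past t w = x].
Proof.
rewrite past_eqE bigcap_seq; apply: bigsetI_measurable => i _.
exact: (draw_measurable XP).
Qed.

Lemma prob_past_eq t (x : t.-tuple 'I_n) :
  P [set w | past t w = x] = ((n%:R ^+ t)^-1)%:E.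
Proof.
rewrite past_eqE (draw_independent XP _ (iota_uniq 0 t)).
rewrite (eq_bigr (fun=> (n%:R^-1)%:E)); last by move=> i _; exact: (draw_uniform XP).
rewrite -[in LHS](subn0 t) -/(index_iota 0 t) big_mkord prodEFin prodr_const card_ord.
by rewrite exprVn.
Qed.

Lemma past_in_seq t (s : seq (t.-tuple 'I_n)) : uniq s ->
  measurable [set w | past t w \in s] /\
  P [set w | past t w \in s] = ((size s)%:R / n%:R ^+ t)%:E.
Proof.
elim: s => [_|x s IH /= /andP[xs us]].
  rewrite (_ : [set w | _] = set0); last by apply/seteqP; split.
  by rewrite measure0 mul0r; split.
have [ms Ps] := IH us.
have -> : [set w | past t w \in x :: s] =
    [set w | past t w = x] `|` [set w | past t w \in s].
  apply/seteqP; split => w /=; rewrite inE; first by move=> /orP[/eqP|]; [left|right].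
  by move=> [->|->]; rewrite ?eqxx ?orbT.
have mx := measurable_past_eq x; split; first exact: measurableU.
rewrite measureU//.
  rewrite [X in (X + _)%E]prob_past_eq [X in (_ + X)%E]Ps -EFinD; congr EFin.
  by rewrite -[(size s).+1]add1n natrD mulrDl mul1r.
by apply/seteqP; split => // w /= [-> xs']; move: xs; rewrite xs'.
Qed.

Lemma prob_past t (B : pred (t.-tuple 'I_n)) :
  P [set w | B (past t w)] = ((\sum_(x : t.-tuple 'I_n) B x)%:R / n%:R ^+ t)%:E.
Proof.
have [_] := past_in_seq (enum_uniq B).
rewrite -cardE -sum1_card big_mkcond /= => <-; congr (P _).
by apply/seteqP; split => w /=; rewrite mem_enum.
Qed.

Lemma num_collected_nondecr w t u : (t <= u)%N ->
  (num_collected X t w <= num_collected X u w)%N.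
Proof.
move=> tu; rewrite -(subnK tu); elim: (u - t)%N => [|i IH]; first by [].
apply: (leq_trans IH); rewrite addSn !num_collected_past pastS /=.
by case: ifP.
Qed.

Lemma num_collected_le w t : (num_collected X t w <= t)%N.
Proof. by rewrite num_collected_past (leq_trans (size_undup _))// size_tuple. Qed.

Lemma waiting_timeE m w t : (n - m <= num_collected X t w)%N ->
  exists t0, [/\ waiting_time K X m w = t0%:R%:E, (n - m <= num_collected X t0 w)%N
    & forall u, (n - m <= num_collected X u w)%N -> (t0 <= u)%N].
Proof.
move=> ht; have ex : exists u, (n - m <= num_collected X u w)%N by exists t.
case: (ex_minnP ex) => t0 ht0 mint0; exists t0; split => //.
apply/eqP; rewrite eq_le; apply/andP; split.
  by apply: ereal_inf_lbound; exists t0.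
by apply: le_ereal_inf_tmp => _ [u /= hu <-]; rewrite lee_fin ler_nat mint0.
Qed.

Lemma waiting_time_pinfty m w : (forall t, (num_collected X t w < n - m)%N) ->
  waiting_time K X m w = +oo%E.
Proof.
move=> h; rewrite /waiting_time (_ : [set _ | _ in _] = set0) ?ereal_inf0//.
by apply/seteqP; split => // _ [t /= ht _]; move: (h t); rewrite ltnNge ht.
Qed.

(** The number of collected coupons is nondecreasing in time, so a first passage is detected at two
    consecutive times. As [n - m] is positive, the waiting time is never 0 and the successor form
    loses nothing. *)
Lemma waiting_time_eqS m w t : (0 < n - m)%N ->
  waiting_time K X m w = t.+1%:R%:E <->
  (n - m <= num_collected X t.+1 w)%N && (num_collected X t w < n - m)%N.
Proof.
move=> N0; split.
  have [[u hu]|] := pselect (exists u, (n - m <= num_collected X u w)%N); last first.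
    move=> h; rewrite waiting_time_pinfty// => u; rewrite ltnNge; apply/negP => hu.
    by apply: h; exists u.
  have [t0 [-> h0 hmin]] := waiting_timeE hu.
  move=> [/eqP]; rewrite eqr_nat => /eqP t0E; rewrite -t0E h0 /=.
  by rewrite ltnNge; apply/negP => /hmin; rewrite t0E ltnn.
move=> /andP[h1 h2]; have [t0 [-> h0 hmin]] := waiting_timeE h1.
have := hmin _ h1; have : (t < t0)%N.
  rewrite ltnNge; apply/negP => t0t.
  by have := leq_trans h0 (num_collected_nondecr w t0t); rewrite leqNgt h2.
by move=> a b; congr (_%:R%:E); lia.
Qed.

(** Here $a_2<1$ makes the integer shift $c$ equal to 0. *)
Lemma shifted_timeE m w k : 0 <= coef_a K n m 2 < 1 ->
  shifted_time K X m w = k%:~R%:E <->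
  waiting_time K X m w = (k + (n - m)%:Z)%:~R%:E.
Proof.
move=> a01; rewrite /shifted_time (_ : Num.floor _ = 0); last first.
  by apply: Num.Theory.floor_def; rewrite add0r.
rewrite mulr0z adde0 rmorphD /= EFinD -pmulrn.
case: (waiting_time K X m w) => [r| |] //=.
rewrite -EFinB -EFinD; split => -[] h; congr EFin; lra.
Qed.

Definition completing j t (x : t.+1.-tuple 'I_n) :=
  (j < size (undup x))%N && (size (undup (behead x)) <= j)%N.

Lemma completing_past j t w : completing j (past t.+1 w) =
  (j < num_collected X t.+1 w)%N && (num_collected X t w <= j)%N.
Proof. by rewrite /completing !num_collected_past pastS. Qed.

(** With $M=n-m-1$, the value [k] means that draw number $M+k+1$ brings the coupon $M+1$. The
    preceding $M+k$ draws thus show exactly $M$ coupons, and the last draw is new with probability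
    $(n-M)/n$. *)
Lemma shifted_law_nat m k : (0 < n - m)%N -> 0 <= coef_a K n m 2 < 1 ->
  shifted_law P X m k%:Z =
  ((n - (n - m).-1)%:R / n%:R * collect_prob K n (n - m).-1 k)%:E.
Proof.
move=> N0 a01; set M := (n - m).-1.
have NM : (n - m = M.+1)%N by rewrite prednK.
rewrite /shifted_law.
have -> : [set w | shifted_time K X m w = (k%:Z)%:~R%:E] =
   [set w | completing M (past (M + k).+1 w)].
  apply/seteqP; split => w; rewrite /mkset completing_past.
    move=> /(shifted_timeE _ _ a01); rewrite NM -PoszD -pmulrn addnS addnC.
    by move=> /waiting_time_eqS -/(_ N0); rewrite NM ltnS.
  move=> h; apply/(shifted_timeE _ _ a01); rewrite NM -PoszD -pmulrn addnS addnC.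
  by apply/waiting_time_eqS => //; rewrite NM ltnS.
rewrite prob_past sum_completing.
by rewrite /collect_prob natrM exprS invfM mulrACA.
Qed.

Lemma shifted_law_neg m k : 0 <= coef_a K n m 2 < 1 -> k < 0 -> shifted_law P X m k = 0%E.
Proof.
move=> a01 k0; rewrite /shifted_law (_ : [set w | _] = set0) ?measure0//.
apply/seteqP; split => // w /=; rewrite shifted_timeE//.
have [[u hu]|h] := pselect (exists u, (n - m <= num_collected X u w)%N); last first.
  rewrite waiting_time_pinfty// => u; rewrite ltnNge; apply/negP => hu.
  by apply: h; exists u.
have [t0 [-> h0 _]] := waiting_timeE hu.
have := leq_trans h0 (num_collected_le w t0).
move=> h1 [h2]; have : (n - m)%:Z <= k + (n - m)%:Z.
  by rewrite -(ler_int K) -h2 -pmulrn ler_nat.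
by rewrite lerDr leNgt k0.
Qed.

End WaitingTimeLaw.

(** The total variation measure from a Hahn decomposition is finite and dominates the masses of the
    disjoint singletons. *)
Lemma charge_summable (K : realType) (nu : {charge set nat -> \bar K}) :
  exists S : K, forall N, \sum_(j < N) `|fine (nu [set j : nat])| <= S.
Proof.
have [A [B hAB]] := Hahn_decomposition nu.
pose var : {measure set nat -> \bar K} := charge_variation hAB.
have varfin D : var D \is a fin_num by exact: (@fin_num_measure _ _ _ (charge_variation
    hAB)).
exists (fine (var setT)) => N; rewrite -lee_fin fineK// -sumEFin.
apply: (@le_trans _ _ (\sum_(j < N) var [set j : nat])%E).
  apply: lee_sum => j _.
  have : nu [set j : nat] \is a fin_num by exact: fin_num_measure.
  move=> /fineK fE; rewrite -abse_EFin fE; exact: abse_charge_variation.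
rewrite -(@measure_semi_additive_ord_I _ _ _ var (fun j : nat => [set j]))//.
- by apply: le_measure; rewrite ?inE.
- by move=> i j _ _ [x [-> ->]].
Qed.

Lemma sum_sqr_ge L : (L ^ 3 <= 3 * \sum_(i < L.+1) i ^ 2)%N.
Proof.
elim: L => [|L IH]; first by rewrite exp0n.
rewrite big_ord_recr /= mulnDr; move: IH; move: (\sum_(_ < _) _)%N => S.
have -> : (L.+1 ^ 3 = L ^ 3 + 3 * L ^ 2 + 3 * L + 1)%N by rewrite -addn1; ring.
have -> : (L.+1 ^ 2 = L ^ 2 + 2 * L + 1)%N by rewrite -addn1; ring.
lia.
Qed.

Lemma sum_ge L : (L ^ 2 <= 2 * \sum_(i < L.+1) i)%N.
Proof.
elim: L => [|L IH]; first by rewrite exp0n.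
rewrite big_ord_recr /= mulnDr; move: IH; move: (\sum_(_ < _) _)%N => S.
have -> : (L.+1 ^ 2 = L ^ 2 + 2 * L + 1)%N by rewrite -addn1; ring.
lia.
Qed.

(** * Size of the coefficients $a_j$ under the condition $a_2<1$ *)

Section CoefficientBounds.
Variables (K : realType) (n m : nat).
Hypothesis mn : (m < n)%N.
Local Notation a := (coef_a K n m).
Local Notation M := (n - m).-1.

Lemma coef_aE j : a j = \sum_(i < M.+1) (i%:R / (n - i)%:R) ^+ j.
Proof.
rewrite /coef_a big_rev_mkord prednK; last by lia.
rewrite subSS; apply: eq_bigr => i _.
by rewrite subSS subKn//; have := ltn_ord i; lia.
Qed.

Lemma coef_a_ge0 j : 0 <= a j.
Proof. by rewrite coef_aE sumr_ge0// => i _; rewrite exprn_ge0 ?divr_ge0. Qed.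

(** Writing $n=k+(n-k)$ gives $n(n-k)/k^2=q_k+q_k^2$ termwise. *)
Lemma sigma2E : sigma2 K n m = a 1%N + a 2%N.
Proof.
rewrite /sigma2 /coef_a mulr_sumr -big_split /= big_nat [RHS]big_nat.
apply: eq_bigr => k /andP[mk kn].
have k0 : (k%:R : K) != 0 by rewrite pnatr_eq0; lia.
have -> : (n%:R : K) = k%:R + (n - k)%:R by rewrite -natrD subnKC//; lia.
by field.
Qed.

Lemma ratio_ge (i : 'I_M.+1) : i%:R / n%:R <= i%:R / (n - i)%:R :> K.
Proof.
have iM := ltn_ord i; rewrite ler_wpM2l// lef_pV2 ?posrE ?ltr0n ?ler_nat; lia.
Qed.

Lemma coef_a1_ge : M%:R ^+ 2 / (2 * n%:R) <= a 1%N.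
Proof.
rewrite coef_aE; apply: (@le_trans _ _ (\sum_(i < M.+1) i%:R / n%:R)).
  rewrite -mulr_suml invfM mulrA ler_wpM2r ?invr_ge0// ler_pdivrMr//.
  by rewrite -natr_sum mulrC -natrM -natrX ler_nat sum_ge.
by apply: ler_sum => i _; rewrite expr1 ratio_ge.
Qed.

Lemma coef_a2_ge : M%:R ^+ 3 / (3 * n%:R ^+ 2) <= a 2%N.
Proof.
rewrite coef_aE; apply: (@le_trans _ _ (\sum_(i < M.+1) (i%:R / n%:R) ^+ 2)).
  under eq_bigr do rewrite expr_div_n.
  rewrite -mulr_suml invfM mulrA ler_wpM2r ?invr_ge0 ?exprn_ge0// ler_pdivrMr//.
  under eq_bigr do rewrite -natrX.
  by rewrite -natr_sum mulrC -natrM -natrX ler_nat sum_sqr_ge.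
by apply: ler_sum => i _; rewrite lerXn2r ?nnegrE ?divr_ge0 ?ratio_ge.
Qed.

Hypothesis a21 : a 2%N < 1.

Lemma cube_le : (M ^ 3 <= 3 * n ^ 2)%N.
Proof.
have n0 : (0 < n)%N by lia.
have := le_lt_trans coef_a2_ge a21.
rewrite ltr_pdivrMr ?mulr_gt0 ?exprn_gt0 ?ltr0n//.
by rewrite mul1r -!natrX -natrM ltr_nat => /ltnW.
Qed.

Hypothesis n375 : (375 <= n)%N.

(** Otherwise $n^3<125M^3\le375n^2$; this is where the threshold 375 comes from. *)
Lemma five_le : (5 * M <= n)%N.
Proof.
rewrite leqNgt; apply/negP => h; have c := cube_le.
have h3 : (n ^ 3 < (5 * M) ^ 3)%N by rewrite ltn_exp2r.
have : (375 * n ^ 2 <= n ^ 3)%N by rewrite [leqRHS]expnS leq_mul2r n375 orbT.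
move: h3; rewrite expnMn; move: (M ^ 3)%N (n ^ 3)%N (n ^ 2)%N c => x y z; lia.
Qed.

Lemma ratio_le (i : 'I_M.+1) : i%:R / (n - i)%:R <= 5 / 4 * M%:R / n%:R :> K.
Proof.
have iM := ltn_ord i; have f := five_le.
have ni : (0 : K) < (n - i)%:R by rewrite ltr0n; lia.
have np : (0 : K) < n%:R by rewrite ltr0n; lia.
rewrite ler_pdivrMr// mulrAC ler_pdivlMr//.
have h : (4 * (i * n) <= 5 * (M * (n - i)))%N.
  have : (i <= M)%N by lia.
  have : (4 * n <= 5 * (n - i))%N by lia.
  move: (n - i)%N => k; nia.
have : (4 * (i * n))%:R <= (5 * (M * (n - i)))%:R :> K by rewrite ler_nat.
rewrite !natrM; lra.
Qed.

(** The value $1/4$ is $\frac54\cdot\frac15$. Together with $|w|\le2$ it keeps $|q_kw|\le1/2$, the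
    range of the inverse Weierstrass bound. *)
Lemma ratio_le4 k : k \in index_iota m.+1 n.+1 ->
  0 <= ((n - k)%:R / k%:R : K) <= 4^-1.
Proof.
rewrite mem_index_iota => /andP[mk kn]; rewrite divr_ge0//=.
have iM : (n - k < M.+1)%N by lia.
have := ratio_le (Ordinal iM) => /=; rewrite subKn; last by lia.
move=> /le_trans; apply.
have np : (0 : K) < n%:R by rewrite ltr0n; lia.
rewrite ler_pdivrMr//.
have : (5 * M)%:R <= n%:R :> K by rewrite ler_nat five_le.
rewrite natrM; lra.
Qed.

Lemma coef_a_le j : (0 < j)%N -> a j <= M%:R * (5 / 4 * M%:R / n%:R) ^+ j.
Proof.
move=> j0; rewrite coef_aE big_ord_recl mul0r expr0n gtn_eqF// add0r.
apply: (@le_trans _ _ (\sum_(i < M) (5 / 4 * M%:R / n%:R) ^+ j)).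
  by apply: ler_sum => i _; rewrite lerXn2r ?nnegrE ?divr_ge0 ?mulr_ge0 ?ratio_le.
by rewrite sumr_const card_ord -[leLHS]mulr_natl.
Qed.

End CoefficientBounds.

(** * Both characteristic functions as limits of trigonometric sums *)

Section CharacteristicFunctions.
Variable K : realType.

(** With $i=n-k$, each factor is $(1-\frac in)/(1-\frac inz)$. The denominator for $i=0$ is 1, so
    the denominators shift by one against the numerators and the last numerator is left in front, as
    in [collect_prob_cvg]. *)
Lemma prod_geometric (n m : nat) (z : K[i]) : (m < n)%N -> cmod z = 1 ->
  \prod_(m.+1 <= k < n.+1) (1 - ((n - k)%:R / k%:R)%:C * (z - 1))^-1 =
  ((n - (n - m).-1)%:R / n%:R)%:C *
  \prod_(i < (n - m).-1) (((n - i)%:R / n%:R)%:C / (1 - (i.+1%:R / n%:R)%:C * z)).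
Proof.
move=> mn z1; rewrite big_rev_mkord.
have -> : (n.+1 - m.+1 = (n - m).-1.+1)%N by lia.
set M := (n - m).-1; have Mn : (M < n)%N by rewrite /M; lia.
transitivity (\prod_(i < M.+1) (((n - i)%:R / n%:R)%:C * (1 - (i%:R / n%:R)%:C * z)^-1)).
  apply: eq_bigr => i _; have iM := ltn_ord i.
  rewrite subSS subKn; last by lia.
  have nK : (n%:R : K[i]) != 0 by rewrite pnatr_eq0; lia.
  have iK : ((n - i)%:R : K[i]) != 0 by rewrite pnatr_eq0; lia.
  have nE : (n%:R : K[i]) = (n - i)%:R + i%:R by rewrite -natrD subnK//; lia.
  have zK : n%:R - i%:R * z != 0.
    apply/eqP => /subr0_eq h; have := congr1 (@cmod K) h.
    rewrite cmodM z1 mulr1 !cmod_nat => /eqP; rewrite eqr_nat => /eqP; lia.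
  rewrite !rmorphM !fmorphV !rmorph_nat /=.
  have -> : 1 - i%:R / (n - i)%:R * (z - 1) = (n%:R - i%:R * z) / (n - i)%:R.
    by apply: (mulIf iK); rewrite divfK// nE; field.
  have -> : 1 - i%:R / n%:R * z = (n%:R - i%:R * z) / n%:R.
    by field.
  by rewrite !invf_div mulrA divfK.
rewrite !big_split /= big_ord_recr /= [X in _ * X]big_ord_recl /= mul0r rmorph0 mul0r
    subr0 invr1 mul1r.
by rewrite -[LHS]mulrA [RHS]mulrCA.
Qed.

Lemma has_charfunP (nu : {charge set nat -> \bar K}) (phi : K -> K[i]) :
  has_charfun nu phi -> forall t e, 0 < e -> exists N0, forall N, (N0 <= N)%N ->
  cmod (phi t - trig_sum (fun j => fine (nu [set j])) N t) <= e.
Proof.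
move=> h t e e0; have := h t; move=> /cvgrPdist_le/(_ e%:C).
rewrite ltcR => /(_ e0)[N0 _ hN]; exists N0 => N /hN /=.
rewrite big_mkord cmodE lecR; congr (cmod (_ - _) <= _).
by apply: eq_bigr => j _; rewrite expiMn mulrC.
Qed.

End CharacteristicFunctions.

(** * Powers of $n$ in the two error terms *)

Section NumericalBounds.
Variables (K : realType).
Implicit Types (a M r s : K).

(* Here [M = n - m - 1] and [r] is the square root of [n]. *)
Lemma first_term_le (a M r s : K) R : 0 < M -> 0 < r -> M / (2 * r) <= s ->
  a <= M * (5 / 4 * M / r ^+ 2) ^+ R.+1 ->
  a / s ^+ R.+2 <= 2 * (5 / 2) ^+ R.+1 / r ^+ R.
Proof.
move=> M0 r0 Ms aM.
have M2 : 0 < M / (2 * r) by rewrite divr_gt0// mulr_gt0.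
have s0 : 0 < s by exact: lt_le_trans Ms.
rewrite ler_pdivrMr ?exprn_gt0//.
apply: (le_trans aM).
apply: (@le_trans _ _ (2 * (5 / 2) ^+ R.+1 / r ^+ R * (M / (2 * r)) ^+ R.+2)); last first.
  rewrite ler_wpM2l ?mulr_ge0 ?invr_ge0 ?exprn_ge0 ?divr_ge0 ?(ltW r0)//.
  by rewrite lerXn2r ?nnegrE ?(ltW M2) ?(ltW s0).
(* An exact identity: $M(M/r^2)^{R+1}$ is a constant times $r^{-R}(M/(2r))^{R+2}$, so $M$
   disappears. *)
rewrite le_eqVlt; apply/orP; left; apply/eqP.
have -> : 5 / 4 * M / r ^+ 2 = (5 / 2) * (r^-1 * (M / (2 * r))).
  by field; rewrite gt_eqF.
rewrite exprMn [(r^-1 * _) ^+ _]exprMn [_ ^+ R.+2]exprS.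
have -> : r^-1 ^+ R.+1 = (r ^+ R)^-1 * r^-1 by rewrite exprSr exprVn.
by field; rewrite !gt_eqF ?exprn_gt0.
Qed.

(** Let $u=M^3/r^4\le3$. Then $a\le2u$ and $s^3\ge ur/8$, so $R$ of the $3R-1$ factors $u$ cancel
    and leave $r^{-R}$; the other $2R-1$ are bounded by 3. *)
Lemma second_term_le (a M r s : K) R : (0 < R)%N -> 0 < M -> 0 < r -> M / (2 * r) <= s ->
  0 <= a -> a <= M * (5 / 4 * M / r ^+ 2) ^+ 2 -> M ^+ 3 <= 3 * r ^+ 4 ->
  a ^+ (3 * R - 1) / s ^+ (3 * R) <=
    2 ^+ (3 * R - 1) * 8 ^+ R * 3 ^+ (2 * R - 1) / r ^+ R.
Proof.
case: R => // R _ M0 r0 Ms a0 aM M3.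
have M2 : 0 < M / (2 * r) by rewrite divr_gt0// mulr_gt0.
have s0 : 0 < s by exact: lt_le_trans Ms.
have -> : (3 * R.+1 - 1 = R.+1 + (2 * R + 1))%N by lia.
have -> : (2 * R.+1 - 1 = 2 * R + 1)%N by lia.
pose u := M ^+ 3 / r ^+ 4.
have u0 : 0 < u by rewrite divr_gt0 ?exprn_gt0.
have u3 : u <= 3 by rewrite ler_pdivrMr ?exprn_gt0.
have au : a <= 2 * u.
  apply: (le_trans aM); rewrite (_ : M * _ = 25 / 16 * u);
    last by rewrite /u; field; rewrite gt_eqF.
  by rewrite ler_wpM2r ?(ltW u0)//; lra.
rewrite ler_pdivrMr ?exprn_gt0//.
apply: (@le_trans _ _ ((2 * u) ^+ (R.+1 + (2 * R + 1)))).
  have u20 : 0 <= 2 * u := mulr_ge0 (ler0n _ 2) (ltW u0).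
  by rewrite lerXn2r ?nnegrE.
apply: (@le_trans _ _ (2 ^+ (R.+1 + (2 * R + 1)) * 8 ^+ R.+1 * 3 ^+ (2 * R + 1) / r ^+ R.+1
    * (M / (2 * r)) ^+ (3 * R.+1))); last first.
  rewrite ler_wpM2l ?mulr_ge0 ?invr_ge0 ?exprn_ge0 ?(ltW r0)//.
  by rewrite lerXn2r ?nnegrE ?(ltW M2) ?(ltW s0).
have E : (M / (2 * r)) ^+ (3 * R.+1) = u ^+ R.+1 * r ^+ R.+1 / 8 ^+ R.+1.
  rewrite exprM -exprMn -expr_div_n; congr (_ ^+ _).
  by rewrite /u; field; rewrite gt_eqF.
rewrite E exprMn [u ^+ (_ + _)]exprD.
have h : u ^+ (2 * R + 1) <= 3 ^+ (2 * R + 1) by rewrite lerXn2r ?nnegrE ?(ltW u0).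
rewrite (_ : _ / r ^+ R.+1 * _ = 2 ^+ (R.+1 + (2 * R + 1)) *
    (u ^+ R.+1 * 3 ^+ (2 * R + 1))).
  by rewrite ler_wpM2l ?exprn_ge0// ler_wpM2l ?exprn_ge0 ?(ltW u0).
by field; rewrite !gt_eqF ?exprn_gt0.
Qed.

End NumericalBounds.

Lemma waiting_law_charfun (K : realType) (n m : nat) (t e : K) : (m < n)%N -> 0 < e ->
    exists N0, forall N, (N0 <= N)%N ->
  cmod (\prod_(m.+1 <= k < n.+1) (1 - ((n - k)%:R / k%:R)%:C * (expi t - 1))^-1 -
   trig_sum (fun j => (n - (n - m).-1)%:R / n%:R * collect_prob K n (n - m).-1 j) N t) <= e.
Proof.
move=> mn e0; have n0 : (0 < n)%N by lia.
have Mn : ((n - m).-1 < n)%N by lia.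
have [N0 hN0] := @collect_prob_cvg K n n0 (n - m).-1 (expi t) e Mn (cmod_expi t) e0.
exists N0 => N /hN0 h.
rewrite (prod_geometric mn (cmod_expi t)).
set b := (n - (n - m).-1)%:R / n%:R.
have -> : trig_sum (fun j => b * collect_prob K n (n - m).-1 j) N t =
    b%:C * \sum_(k < N) (collect_prob K n (n - m).-1 k)%:C * expi t ^+ k.
  by rewrite mulr_sumr; apply: eq_bigr => j _; rewrite rmorphM mulrA.
rewrite -mulrBr cmodM cmod_real ger0_norm ?divr_ge0// -[leRHS]mul1r.
apply: ler_pM; rewrite ?divr_ge0 ?cmod_ge0//.
by rewrite ler_pdivrMr ?ltr0n// mul1r ler_nat leq_subr.
Qed.

(** * Inversion of the difference of the characteristic functions *)

Section Main.
Variable K : realType.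

Definition first_const R : K := 2 * (5 / 2) ^+ R.+1.
Definition second_const R : K := 2 ^+ (3 * R - 1) * 8 ^+ R * 3 ^+ (2 * R - 1).

Definition main_const R : K := 6 * pointwise_const K R *
  (gauss_const K R.+1 * first_const R + gauss_const K (3 * R - 1) * second_const R).

Lemma main_const_gt0 R : 0 < main_const R.
Proof.
apply: mulr_gt0; first by rewrite mulr_gt0// pointwise_const_gt0.
apply: addr_gt0; apply: mulr_gt0; try exact: gauss_const_gt0.
  by apply: mulr_gt0 => //; apply: exprn_gt0; rewrite divr_gt0.
by apply: mulr_gt0; [apply: mulr_gt0|]; exact: exprn_gt0.
Qed.

Variables (n m R : nat).
Hypotheses (hR : (3 <= R)%N) (mn : (m < n)%N) (n375 : (375 <= n)%N).
Hypothesis a21 : coef_a K n m 2 < 1.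
Local Notation a := (coef_a K n m).
Local Notation M := (n - m).-1.

Definition charfun_error (t : K) : K[i] :=
  \prod_(m.+1 <= k < n.+1) (1 - ((n - k)%:R / k%:R)%:C * (expi t - 1))^-1 -
  cexp ((sigma2 K n m)%:C * (expi t - 1)) *
    (map_poly (real_complex K) (poly_H K n m R)).[expi t - 1].

Lemma charfun_error_le t :
  cmod (charfun_error t) <= pointwise_const K R *
    expR (- (sigma2 K n m * (cmod (expi t - 1) ^+ 2 / 2))) *
    (a R.+1 * cmod (expi t - 1) ^+ R.+1 + (a 2%N * cmod (expi t - 1)) ^+ (3 * R - 1)).
Proof.
rewrite /charfun_error (sigma2E K mn).
apply: (@pointwise_estimate K (index_iota m.+1 n.+1) (fun k => (n - k)%:R / k%:R) R) => //.
- by move=> k; exact: ratio_le4.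
- exact: ltW.
- by apply: (le_trans (cmodB _ _)); rewrite cmod_expi cmod1.
- by rewrite sqr_cmod_expiB1 /=; lra.
Qed.

Lemma charfun_error_decay s t : 0 < s -> s ^+ 2 = sigma2 K n m ->
  cmod (charfun_error t) <= pointwise_const K R *
    (a R.+1 * (gauss_const K R.+1 / s ^+ R.+1) +
     a 2%N ^+ (3 * R - 1) * (gauss_const K (3 * R - 1) / s ^+ (3 * R - 1))) /
    (1 + s ^+ 2 * cmod (expi t - 1) ^+ 2).
Proof.
move=> s0 sE; apply: (le_trans (charfun_error_le t)); rewrite -sE.
set y := cmod _; have y0 : 0 <= y by exact: cmod_ge0.
have h1 := gaussian_decay R.+1 s0 y0; have h2 := gaussian_decay (3 * R - 1) s0 y0.
move: h1 h2; set e := expR _; set D := (1 + _)^-1.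
set g1 := gauss_const K R.+1 / _; set g2 := gauss_const K (3 * R - 1) / _.
rewrite exprMn; set y1 := y ^+ R.+1; set y2 := y ^+ (3 * R - 1) => h1 h2.
set b := a 2%N ^+ (3 * R - 1).
rewrite [leLHS](_ : _ = pointwise_const K R * (a R.+1 * (e * y1) + b * (e * y2)));
    last by ring.
rewrite [leRHS](_ : _ = pointwise_const K R * (a R.+1 * (g1 * D) + b * (g2 * D)));
    last by ring.
rewrite ler_wpM2l ?(ltW (pointwise_const_gt0 _ _))//.
by apply: lerD; rewrite ler_wpM2l ?exprn_ge0 ?coef_a_ge0.
Qed.

Lemma coef_error_le (dd : nat -> K) S :
  (forall N, \sum_(j < N) `|dd j| <= S) ->
  (forall t e, 0 < e -> exists N0, forall N, (N0 <= N)%N ->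
     cmod (charfun_error t - trig_sum dd N t) <= e) ->
  forall k, `|dd k| <= main_const R / Num.sqrt n%:R ^+ R.
Proof.
move=> dS dPhi k.
have n0 : (0 < n)%N by lia.
have nK : 0 < (n%:R : K) by rewrite ltr0n.
set r := Num.sqrt (n%:R : K).
have r0 : 0 < r by rewrite sqrtr_gt0.
have rn : r ^+ 2 = n%:R by rewrite sqr_sqrtr// ltW.
have pc0 := pointwise_const_gt0 K R.
(* If $M=0$, every $a_j$ with $j\ge1$ vanishes and so does $\sigma$, which cannot serve as the
   scale. The error function is then 0, and inversion is applied with amplitude 0 and the arbitrary
   scale 1. *)
have [M0|M0] := posnP M.
  have a0 j : (0 < j)%N -> a j = 0.
    move=> j0; apply/eqP; rewrite eq_le coef_a_ge0// andbT.
    by apply: (le_trans (coef_a_le mn a21 n375 j0)); rewrite M0 !mul0r.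
  have h t : cmod (charfun_error t) <= 0 / (1 + 1 ^+ 2 * cmod (expi t - 1) ^+ 2).
    rewrite mul0r; apply: (le_trans (charfun_error_le t)).
    rewrite a0// a0// !mul0r expr0n (_ : (3 * R - 1 == 0)%N = false) ?addr0 ?mulr0//.
    by apply/negbTE; lia.
  apply: (le_trans (inversion_bound ltr01 (lexx 0) dS dPhi h k)).
  by rewrite mul0r divr_ge0 ?exprn_ge0 ?(ltW r0) ?(ltW (main_const_gt0 R)).
have MK : 0 < (M%:R : K) by rewrite ltr0n.
have sig0 : M%:R ^+ 2 / (2 * n%:R) <= sigma2 K n m.
  by rewrite (sigma2E K mn); apply: (le_trans (coef_a1_ge K mn)); rewrite lerDl coef_a_ge0.
have sigp : 0 < sigma2 K n m.
  by apply: lt_le_trans sig0; rewrite divr_gt0 ?exprn_gt0// mulr_gt0.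
pose s := Num.sqrt (sigma2 K n m).
have s0 : 0 < s by rewrite sqrtr_gt0.
have sE : s ^+ 2 = sigma2 K n m by rewrite sqr_sqrtr// ltW.
(* Square root of $M^2/(2n)\le\sigma^2$, with $1/4$ in place of $1/2$ to keep the constant
   rational. *)
have Ms : M%:R / (2 * r) <= s.
  have h0 : 0 <= M%:R / (2 * r) by rewrite divr_ge0// mulr_ge0// ltW.
  rewrite -(@ler_pXn2r _ 2)// ?nnegrE ?(ltW s0)// sE.
  apply: le_trans sig0; rewrite expr_div_n exprMn rn.
  rewrite ler_wpM2l ?exprn_ge0// lef_pV2 ?posrE ?mulr_gt0 ?exprn_gt0//.
  by rewrite ler_wpM2r ?(ltW nK)// expr2; lra.
pose A := pointwise_const K R *
    (a R.+1 * (gauss_const K R.+1 / s ^+ R.+1) +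
     a 2%N ^+ (3 * R - 1) * (gauss_const K (3 * R - 1) / s ^+ (3 * R - 1))).
have a0 j : 0 <= a j by exact: coef_a_ge0.
have g0 p : 0 <= gauss_const K p by exact/ltW/gauss_const_gt0.
have A0 : 0 <= A.
  by rewrite mulr_ge0 ?(ltW pc0)// addr_ge0// mulr_ge0 ?exprn_ge0 ?divr_ge0 ?exprn_ge0
      ?(ltW s0).
apply: (le_trans (inversion_bound s0 A0 dS dPhi (fun t => charfun_error_decay t s0 sE) k)).
have h1 : a R.+1 / s ^+ R.+2 <= first_const R / r ^+ R.
  apply: (@first_term_le _ _ M%:R) => //; rewrite rn; exact: coef_a_le.
have h2 : a 2%N ^+ (3 * R - 1) / s ^+ (3 * R) <= second_const R / r ^+ R.
  apply: (@second_term_le _ _ M%:R) => //; first by lia.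
    by rewrite rn; exact: coef_a_le.
  have -> : r ^+ 4 = n%:R ^+ 2 by rewrite -rn -exprM.
  by rewrite -!natrX -natrM ler_nat; exact: (cube_le mn a21).
(* The extra factor [s] is the one gained by averaging over the circle. *)
have e3 : s ^+ (3 * R) = s ^+ (3 * R - 1) * s by rewrite -exprSr; congr (_ ^+ _); lia.
have sn : s != 0 by rewrite gt_eqF.
have -> : A * (6 / s) = 6 * pointwise_const K R *
   (gauss_const K R.+1 * (a R.+1 / s ^+ R.+2) +
    gauss_const K (3 * R - 1) * (a 2%N ^+ (3 * R - 1) / s ^+ (3 * R))).
  by rewrite /A e3 [s ^+ R.+2]exprSr !invfM; ring.
rewrite [leRHS](_ : _ = 6 * pointwise_const K R *
   (gauss_const K R.+1 * (first_const R / r ^+ R) +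
    gauss_const K (3 * R - 1) * (second_const R / r ^+ R))); last first.
  by rewrite /main_const; ring.
rewrite ler_wpM2l ?mulr_ge0 ?(ltW pc0)//.
by apply: lerD; rewrite ler_wpM2l.
Qed.

End Main.

Theorem theorem7p0p2 (K : realType) (R : nat) (hR : (3 <= R)%N) :
  exists (nR : nat) (CR : K), 0 < CR /\
    forall (n m : nat), (1 <= m)%N -> (m <= n - 1)%N -> (nR <= n)%N ->
    coef_a K n m 2 < 1 ->
    forall (d : measure_display) (T : measurableType d) (P : probability T K)
      (X : nat -> T -> 'I_n), uniform_draws P X ->
    forall nu : {charge set nat -> \bar K}, poisson_charlier n m R nu ->
    (ereal_sup [set `| shifted_law P X m k
                       - nu [set j : nat | j%:Z = k] | | k in [set: int]]
     <= (CR / Num.sqrt n%:R ^+ R)%:E)%E.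
Proof.
exists 375%N, (main_const K R); split; first exact: main_const_gt0.
move=> n m _ mn1 n375 a21 d T P X XP nu hnu.
have n0 : (0 < n)%N by lia.
have mn : (m < n)%N by lia.
have N0 : (0 < n - m)%N by lia.
have a01 : 0 <= coef_a K n m 2 < 1 by rewrite coef_a_ge0.
have bound0 : 0 <= main_const K R / Num.sqrt n%:R ^+ R.
  by rewrite divr_ge0 ?exprn_ge0 ?sqrtr_ge0// ltW// main_const_gt0.
(* At a negative integer both masses are 0: at least [n - m] draws are necessary, and [nu] lives on
   [nat]. *)
apply: ge_ereal_sup => _ [[k|k] _ <-]; last first.
  rewrite (@shifted_law_neg K n d T P X m)// (_ : [set _ | _] = set0).
    by rewrite charge0 sube0 abse0 lee_fin.
  by apply/seteqP; split.
rewrite (_ : [set j : nat | _] = [set k]); last first.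
  by apply/seteqP; split => j /=; [case|move=> ->].
rewrite (shifted_law_nat n0 XP k N0 a01).
have nufin : nu [set k] \is a fin_num by exact: fin_num_measure.
rewrite -(fineK nufin) -EFinB abse_EFin lee_fin.
pose u j := (n - (n - m).-1)%:R / n%:R * collect_prob K n (n - m).-1 j.
pose v j := fine (nu [set j]).
have [S1 hS1] := @collect_prob_bounded K n n0 (n - m).-1 ltac:(lia).
have [S2 hS2] := charge_summable nu.
have c0 : 0 <= (n - (n - m).-1)%:R / n%:R :> K by rewrite divr_ge0.
(* The inversion is applied to the difference of the two mass sequences, whose trigonometric sums
   converge to the difference of the characteristic functions. *)
apply: (@coef_error_le K n m R hR mn n375 a21 (fun j => u j - v j)
  ((n - (n - m).-1)%:R / n%:R * S1 + S2)).
  move=> N; apply: (@le_trans _ _ (\sum_(j < N) (u j + `|v j|))).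
    apply: ler_sum => j _; apply: (le_trans (ler_normB _ _)).
    by rewrite lerD2r ger0_norm// mulr_ge0// collect_prob_ge0.
  rewrite big_split /=; apply: lerD; last exact: hS2.
  rewrite (_ : \sum_(i < N) u i = (n - (n - m).-1)%:R / n%:R * \sum_(i < N)
      collect_prob K n (n - m).-1 i).
    exact: ler_wpM2l.
  by rewrite mulr_sumr.
move=> t e e0; have e2 : 0 < e / 2 by rewrite divr_gt0.
have [N1 hN1] := waiting_law_charfun t mn e2.
have [N2 hN2] := has_charfunP hnu t e2.
exists (maxn N1 N2) => N; rewrite geq_max => /andP[/hN1 h1 /hN2 h2].
have -> : trig_sum (fun j => u j - v j) N t = trig_sum u N t - trig_sum v N t.
  by rewrite /trig_sum -sumrB; apply: eq_bigr => j _; rewrite rmorphB mulrBl.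
set p := \prod_(_ <= k < _) _ in h1; move: h2; cbv zeta; set c := (cexp _ * _) => h2.
have -> : charfun_error n m R t - (trig_sum u N t - trig_sum v N t) =
  (p - trig_sum u N t) - (c - trig_sum v N t) by rewrite /charfun_error -/p -/c; ring.
apply: (le_trans (cmodB _ _)); have -> : e = e / 2 + e / 2 by lra.
exact: lerD.
Qed.
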